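(* For $\alpha\in FT_1$ let $\mu_1(\alpha)=\mu(\alpha)$ and define by induction $\mu_k(\alpha)=\mu(\mu_{k-1}(\alpha))$ if $\mu_{k-1}(\alpha)\in FT_1$. Let $n\ge2$ be an integer, and suppose that $\alpha\in FT_1$, that $\mu_k(\alpha)\in FT_1$ for $k=1,\ldots,n-1$, and that $\mu_n(\alpha)=\alpha$. Denote $y_j(z)=\int_{-\infty}^{+\infty}\frac{\mu_j(\alpha)(dw)}{w-z}$ for $j=1,\ldots,n$ and $\Im z>0$. Then on $\{z\in\mathbb{C}:\Im z>0\}$ $$(y_1',\,y_2',\ldots,y_n')=(y_ny_1,\;y_1y_2,\ldots,\;y_{n-1}y_n).$$ In particular, if $n=2$ then $\alpha$ is Cauchy or Dirac.
   Context: $FT_1$ is the set of probabilities $\alpha$ on $\mathbb{R}$ with $\int\log(1+|x|)\alpha(dx)<\infty$. For $\alpha\in FT_1$, let $B_1,Y_1,B_2,Y_2,\ldots$ be independent with $B_k\sim\alpha$ and $Y_k$ uniform on $(0,1)$ (i.e. $\beta(1,1)$), and put $W_1=Y_1$, $W_k=Y_k(1-Y_{k-1})\cdots(1-Y_1)$ for $k>1$. The series $\sum_{k\ge1}W_kB_k$ converges absolutely almost surely, and $\mu(\alpha)$ denotes its distribution (it is the law of $\int x\,P(dx)$ for a Dirichlet random probability $P=\sum_k W_k\delta_{B_k}\sim\mathcal{D}(\alpha)$). ''Cauchy'' means $\alpha(dx)=\frac1\pi\frac{b\,dx}{(x-a)^2+b^2}$ for some $a\in\mathbb{R}$, $b>0$;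 ''Dirac'' means $\alpha=\delta_a$ for some $a\in\mathbb{R}$. *)

(* Defs.v *)
From HB Require Import structures.
From mathcomp Require Import all_boot all_order all_algebra.
From mathcomp Require Import all_classical all_reals all_analysis.
From mathcomp Require Import complex.

Set Implicit Arguments.
Unset Strict Implicit.
Unset Printing Implicit Defensive.

Import Order.TTheory GRing.Theory Num.Theory.
Import numFieldNormedType.Exports.

Local Open Scope classical_set_scope.
Local Open Scope ring_scope.

(* A measure is a function on all sets, constrained only on the measurable
   ones: two measures are the same when they agree on measurable sets. *)
Definition same_law d (T : measurableType d) (R : realType)
    (m1 m2 : set T -> \bar R) : Prop :=
  forall A, measurable A -> m1 A = m2 A.

Definition mutually_independent d d' (T : measurableType d)
    (T' : measurableType d') (R : realType) (P : probability T R) (I : eqType)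
    (X : I -> {RV P >-> T'}) : Prop :=
  forall (s : seq I) (A : I -> set T'), uniq s ->
    (forall i, measurable (A i)) ->
    P (\bigcap_(i in [set` s]) (X i @^-1` A i)) =
    (\prod_(i <- s) P (X i @^-1` A i))%E.

Section Dirichlet_means.
Context {R : realType}.

Definition FT1 (alpha : probability R R) : Prop :=
  (\int[alpha]_x (ln (1 + `|x|))%:E < +oo)%E.

(* Indices start at 0: [stick_weight y k] is the W_(k+1) built from
   Y_(j+1) = y j. *)
Definition stick_weight (y : nat -> R) (k : nat) : R :=
  y k * \prod_(j < k) (1 - y j).

(* [is_mu alpha nu] : nu is the distribution mu(alpha). The law of the series
   depends on alpha only, not on the space and the variables realizing it. *)
Definition is_mu (alpha nu : probability R R) : Prop :=
  exists (d : measure_display) (T : measurableType d) (P : probability T R)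
    (B Y : nat -> {RV P >-> R}) (X : {RV P >-> R}),
  [/\ mutually_independent
        (fun i : nat + nat => match i with inl k => B k | inr k => Y k end),
      forall k, same_law (distribution P (B k)) alpha,
      forall k, same_law (distribution P (Y k)) (uniform_prob (@ltr01 R)),
      {ae P, forall t,
        series (fun k => stick_weight (fun j => Y j t) k * B k t) @ \oo
          --> X t}
    & same_law (distribution P X) nu].

(* For 'Im z > 0 the integrand is bounded and continuous in w, so both integrals
   are those of integrable functions. *)
Definition cauchy_transform (nu : probability R R) (z : R[i]^o) : R[i]^o :=
  ((\int[nu]_w complex.Re (((w%:C)%C - z)^-1))%R
   +i* (\int[nu]_w complex.Im (((w%:C)%C - z)^-1))%R)%C.

Definition is_Cauchy (alpha : probability R R) : Prop :=
  exists a b : R, 0 < b /\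
    same_law alpha (fun A =>
      \int[lebesgue_measure]_(x in A)
         (pi^-1 * (b / ((x - a) ^+ 2 + b ^+ 2)))%:E)%E.

Definition is_Dirac (alpha : probability R R) : Prop :=
  exists a : R, same_law alpha \d_a.

End Dirichlet_means.

(* Main.v *)
(* If [X] is the mean of a Dirichlet process with parameter [alpha], then
   [X = Y1 B1 + (1 - Y1) X'] with [X'] a copy of [X] independent of [(Y1, B1)],
   and the integral of [1 / (y p + (1 - y) q) ^ 2] over [0 <= y <= 1] is
   [1 / (p q)]. With [p = B1 - z] and [q = X' - z] the expectation of
   [1 / (X - z) ^ 2], which is the derivative of the Cauchy transform of
   [mu(alpha)], is therefore the product of the Cauchy transforms of [alpha] and
   [mu(alpha)]. The recursion is applied to the partial sums of the series, so
   that only finitely many variables occur, before passing to the limit by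
   dominated convergence.

   When [n = 2], [y1 - y2] has derivative zero and is [O(1 / Im z)], so
   [y1 = y2 = y], [y' = y ^ 2] and [y z = 1 / (k - z)] with [Im k <= 0]. If [k] is
   real, [1 / ((w - k) ^ 2 + 1)] has mean [1], which forces [w = k] almost surely.
   Otherwise, integrating [Im y] along a horizontal segment at height [eta] gives
   differences of arctangents, and letting [eta] tend to [0] recovers the Cauchy
   distribution on intervals (Stieltjes inversion). *)
Require Import Defs.
From HB Require Import structures.
From mathcomp Require Import all_boot all_order all_algebra.
From mathcomp Require Import all_classical all_reals all_analysis.
From mathcomp Require Import complex.
From mathcomp Require Import measurable_realfun.
From mathcomp Require Import ring lra.
Import Order.TTheory GRing.Theory Num.Theory.
Import numFieldNormedType.Exports.
Local Open Scope classical_set_scope.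
Local Open Scope ring_scope.

Set Implicit Arguments.
Unset Strict Implicit.

(** * Expectations of bounded complex functions *)

Section ComplexExpectation.
Context {R : realType}.

(** Measurability with a uniform bound is stable under sums, products and composition and gives
    integrability under every probability, so integrability is never proved integrand by
    integrand. *)
Definition bounded_mfun d (T : measurableType d) (f : T -> R) :=
  measurable_fun setT f /\ exists M, forall x, `|f x| <= M.

Definition bounded_cmfun d (T : measurableType d) (f : T -> R[i]) :=
  bounded_mfun (fun x => complex.Re (f x)) /\
  bounded_mfun (fun x => complex.Im (f x)).

(** Integration is done on real and imaginary parts, in the same shape as [cauchy_transform], which
    is thus convertible to an expectation of the resolvent. *)
Definition cexpect d (T : measurableType d) (P : probability T R)
    (f : T -> R[i]) : R[i] :=
  ((\int[P]_x complex.Re (f x))%R +i* (\int[P]_x complex.Im (f x))%R)%C.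

Lemma bounded_mfun_integrable d (T : measurableType d) (P : probability T R) f :
  bounded_mfun f -> P.-integrable setT (EFin \o f).
Proof.
move=> [mf [M fM]]; apply: measurable_bounded_integrable => //.
  by rewrite -ge0_fin_numE// fin_num_measure.
exists M; split; first by rewrite num_real.
by move=> x Mx y _ /=; exact: le_trans (fM y) (ltW Mx).
Qed.

Section Algebra.
Context d (T : measurableType d).
Implicit Types f g : T -> R.

Lemma bounded_mfun_cst (c : R) : bounded_mfun (fun _ : T => c).
Proof. by split; [exact: measurable_cst|exists `|c|]. Qed.

Lemma bounded_mfunD f g :
  bounded_mfun f -> bounded_mfun g -> bounded_mfun (fun x => f x + g x).
Proof.
move=> [mf [M fM]] [mg [N gN]]; split; first exact: measurable_funD.
by exists (M + N) => x; apply: le_trans (ler_normD _ _) _; exact: lerD.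
Qed.

Lemma bounded_mfunM f g :
  bounded_mfun f -> bounded_mfun g -> bounded_mfun (fun x => f x * g x).
Proof.
move=> [mf [M fM]] [mg [N gN]]; split; first exact: measurable_funM.
by exists (M * N) => x; rewrite normrM ler_pM.
Qed.

Lemma bounded_mfunB f g :
  bounded_mfun f -> bounded_mfun g -> bounded_mfun (fun x => f x - g x).
Proof.
move=> [mf [M fM]] [mg [N gN]]; split; first exact: measurable_funB.
by exists (M + N) => x; apply: le_trans (ler_normB _ _) _; exact: lerD.
Qed.

End Algebra.

Lemma bounded_mfun_comp d d' (T : measurableType d) (T' : measurableType d')
    (g : T' -> T) (f : T -> R) :
  measurable_fun setT g -> bounded_mfun f -> bounded_mfun (f \o g).
Proof.
move=> mg [mf [M fM]]; split; first exact: measurableT_comp.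
by exists M => x; exact: fM.
Qed.

Lemma Re_mulc (x y : R[i]) :
  complex.Re (x * y) = complex.Re x * complex.Re y - complex.Im x * complex.Im y.
Proof. by case: x; case: y. Qed.

Lemma Im_mulc (x y : R[i]) :
  complex.Im (x * y) = complex.Re x * complex.Im y + complex.Im x * complex.Re y.
Proof. by case: x; case: y. Qed.

Lemma Re_addc (x y : R[i]) :
  complex.Re (x + y) = complex.Re x + complex.Re y.
Proof. by case: x; case: y. Qed.

Lemma Im_addc (x y : R[i]) :
  complex.Im (x + y) = complex.Im x + complex.Im y.
Proof. by case: x; case: y. Qed.

Lemma Re_subc (x y : R[i]) :
  complex.Re (x - y) = complex.Re x - complex.Re y.
Proof. by case: x; case: y. Qed.

Lemma Im_subc (x y : R[i]) :
  complex.Im (x - y) = complex.Im x - complex.Im y.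
Proof. by case: x; case: y. Qed.

Definition complex_partsE :=
  (Re_mulc, Im_mulc, Re_subc, Im_subc, Re_addc, Im_addc).

Lemma bounded_cmfun_cst d (T : measurableType d) (c : R[i]) :
  bounded_cmfun (fun _ : T => c).
Proof. by split; exact: bounded_mfun_cst. Qed.

Lemma bounded_cmfunB d (T : measurableType d) (f g : T -> R[i]) :
  bounded_cmfun f -> bounded_cmfun g -> bounded_cmfun (fun x => f x - g x).
Proof.
by move=> [f1 f2] [g1 g2]; split; under eq_fun do rewrite complex_partsE;
  exact: bounded_mfunB.
Qed.

Lemma bounded_cmfunM d (T : measurableType d) (f g : T -> R[i]) :
  bounded_cmfun f -> bounded_cmfun g -> bounded_cmfun (fun x => f x * g x).
Proof.
move=> [f1 f2] [g1 g2]; split; under eq_fun do rewrite complex_partsE.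
  by apply: bounded_mfunB; exact: bounded_mfunM.
by apply: bounded_mfunD; exact: bounded_mfunM.
Qed.

Lemma bounded_cmfun_comp d d' (T : measurableType d) (T' : measurableType d')
    (g : T' -> T) (f : T -> R[i]) :
  measurable_fun setT g -> bounded_cmfun f -> bounded_cmfun (f \o g).
Proof.
by move=> mg [f1 f2]; split;
  [exact: (bounded_mfun_comp mg f1)|exact: (bounded_mfun_comp mg f2)].
Qed.

Section Linearity.
Context d (T : measurableType d) (P : probability T R).
Implicit Types f g : T -> R[i].

Lemma cexpectB f g : bounded_cmfun f -> bounded_cmfun g ->
  cexpect P (fun x => f x - g x) = cexpect P f - cexpect P g.
Proof.
move=> [f1 f2] [g1 g2]; apply/eqP; rewrite eq_complex /cexpect/=.
by apply/andP; split; rewrite -RintegralB//; do ?[exact: bounded_mfun_integrable];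
  under eq_Rintegral do rewrite complex_partsE.
Qed.

Lemma cexpectZl (c : R[i]) f : bounded_cmfun f ->
  cexpect P (fun x => c * f x) = c * cexpect P f.
Proof.
move=> [f1 f2]; apply/eqP; rewrite eq_complex /cexpect/= !complex_partsE/=.
have i1 := bounded_mfun_integrable P f1.
have i2 := bounded_mfun_integrable P f2.
have m k h : bounded_mfun h -> P.-integrable setT (EFin \o (fun x : T =>
  (k : R) * h x)).
  by move=> bh; apply: bounded_mfun_integrable; apply: bounded_mfunM => //;
    exact: bounded_mfun_cst.
by apply/andP; split; under eq_Rintegral do rewrite complex_partsE;
  rewrite ?(RintegralB measurableT (m _ _ f1) (m _ _ f2)) ?(RintegralD
    measurableT (m _ _ f2) (m _ _ f1)) !RintegralZl.
Qed.

Lemma cexpectZr (c : R[i]) f : bounded_cmfun f ->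
  cexpect P (fun x => f x * c) = cexpect P f * c.
Proof.
by move=> bf; rewrite mulrC -cexpectZl//; congr cexpect; apply/funext => x;
  rewrite mulrC.
Qed.

Lemma Rintegral_prob_cst (c : R) : \int[P]_x c = c.
Proof.
rewrite Rintegral_cst//.
by have -> : (P : {measure set T -> \bar R}) setT = 1%E;
  [exact: probability_setT|rewrite mulr1].
Qed.

Lemma norm_complex_le (z : R[i]) (M : R) :
  `|complex.Re z| <= M -> `|complex.Im z| <= M -> `|z| <= (2 * M)%:C%C.
Proof.
move=> h1 h2; have M0 : 0 <= M by exact: le_trans (normr_ge0 _) h1.
rewrite normc_def lecR -[leRHS]ger0_norm ?mulr_ge0// -sqrtr_sqr ler_sqrt ?sqr_ge0//.
rewrite exprMn -[X in X + _]real_normK ?num_real// -[X in _ + X]real_normK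
  ?num_real//.
have e1 : `|complex.Re z| ^+ 2 <= M ^+ 2 by rewrite ler_sqr ?nnegrE.
have e2 : `|complex.Im z| ^+ 2 <= M ^+ 2 by rewrite ler_sqr ?nnegrE.
nra.
Qed.

Lemma normr_Re_le (z : R[i]) (M : R) : `|z| <= M%:C%C -> `|complex.Re z| <= M.
Proof. by move=> h; rewrite -lecR; exact: le_trans (normc_ge_Re _) h. Qed.

Lemma normr_Im_le (z : R[i]) (M : R) : `|z| <= M%:C%C -> `|complex.Im z| <= M.
Proof.
move=> h; have := @normr_Re_le (z * 'i%C) M.
rewrite ReiNIm normrN; apply; rewrite normrM.
by rewrite [`|'i%C|]normc_def/= expr0n/= expr1n add0r sqrtr1 mulr1.
Qed.

(** Bounding the two parts separately costs the factor 2, harmless in the estimates below. *)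
Lemma norm_cexpect_le f (M : R) : bounded_cmfun f ->
  (forall x, `|f x| <= M%:C%C) -> `|cexpect P f| <= (2 * M)%:C%C.
Proof.
move=> [f1 f2] fM.
have H h : bounded_mfun h -> (forall x, `|h x| <= M) -> `|\int[P]_x h x| <= M.
  move=> bh hM; have ih := bounded_mfun_integrable P bh.
  apply: le_trans (le_normr_Rintegral _ ih) _ => //.
  have -> : M = \int[P]_x (cst M x).
    by rewrite Rintegral_prob_cst.
  apply: le_Rintegral => //.
    exact: integrable_norm.
  by apply: bounded_mfun_integrable; exact: bounded_mfun_cst.
apply: norm_complex_le => /=; apply: H => // x.
  exact: normr_Re_le.
exact: normr_Im_le.
Qed.

End Linearity.

Lemma cexpect_same_law d (T : measurableType d) (P Q : probability T R) f :
  same_law P Q -> cexpect P f = cexpect Q f.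
Proof.
move=> PQ; rewrite /cexpect /Rintegral.
by congr (fine _ +i* fine _)%C; apply: eq_measure_integral => A mA _; exact: PQ.
Qed.

Lemma cexpect_distribution d d' (T : measurableType d) (T' : measurableType d')
    (P : probability T R) (X : {RV P >-> T'}) f : bounded_cmfun f ->
  cexpect (distribution P X) f = cexpect P (f \o X).
Proof.
move=> [f1 f2]; rewrite /cexpect /Rintegral.
congr (fine _ +i* fine _)%C; rewrite integral_distribution//=.
- by apply/measurable_EFinP; case: f1.
- exact: (bounded_mfun_integrable P (bounded_mfun_comp (measurable_funPT X) f1)).
- by apply/measurable_EFinP; case: f2.
- exact: (bounded_mfun_integrable P (bounded_mfun_comp (measurable_funPT X) f2)).
Qed.

Lemma Rintegral_prod d1 d2 (T1 : measurableType d1) (T2 : measurableType d2)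
    (P1 : probability T1 R) (P2 : probability T2 R) (f : T1 * T2 -> R) :
  bounded_mfun f ->
  \int[(P1 \x P2)%E]_x f x = \int[P1]_x \int[P2]_y f (x, y).
Proof.
move=> bf; rewrite /Rintegral -integral12_prod_meas1; last first.
  exact: bounded_mfun_integrable.
congr fine; apply: eq_integral => x _; rewrite /fubini_F fineK//.
apply: integrable_fin_num => //; apply: bounded_mfun_integrable.
by apply: (bounded_mfun_comp (g := pair x)) => //.
Qed.

Lemma cexpect_prod d1 d2 (T1 : measurableType d1) (T2 : measurableType d2)
    (P1 : probability T1 R) (P2 : probability T2 R) (f : T1 * T2 -> R[i]) :
  bounded_cmfun f ->
  cexpect (P1 \x P2)%E f = cexpect P1 (fun x => cexpect P2 (fun y => f (x, y))).
Proof. by move=> [f1 f2]; rewrite /cexpect !Rintegral_prod. Qed.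

End ComplexExpectation.

(** * Independence *)

Lemma probability_lty {R : realType} d (T : measurableType d)
    (P : probability T R) : (P setT < +oo)%E.
Proof. by rewrite probability_setT ltry. Qed.

Section Products.
Context {R : realType} d1 d2 (T1 : measurableType d1) (T2 : measurableType d2).

(** Rectangles are a pi-system generating the product sigma-algebra. Finite measures are allowed,
    not just probabilities, because [indep_of_pair] applies this to a restricted measure. *)
Lemma measure_prod_unique (m m' : {measure set (T1 * T2)%type -> \bar R}) :
  (m setT < +oo)%E ->
  (forall A B, measurable A -> measurable B -> m (A `*` B) = m' (A `*` B)) ->
  forall D, measurable D -> m D = m' D.
Proof.
move=> mfin mm' D mD.
pose C : set (set (T1 * T2)%type) :=
  [set A `*` B | A in measurable & B in measurable].
apply: (measure_unique C (fun=> setT)) => //.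
- exact: measurable_prod_measurableType.
- move=> _ _ [A mA [B mB <-]] [A' mA' [B' mB' <-]].
  by exists (A `&` A'); [exact: measurableI|exists (B `&` B');
    [exact: measurableI|exact: setXI]].
- by move=> _; exists setT => //; exists setT => //; rewrite setXTT.
- by rewrite bigcup_const//; exists 0%N.
- by move=> _ [A mA [B mB <-]]; exact: mm'.
Qed.

Lemma same_law_prod (P1 P1' : probability T1 R) (P2 P2' : probability T2 R) :
  same_law P1 P1' -> same_law P2 P2' ->
  same_law (P1 \x P2)%E (P1' \x P2')%E.
Proof.
move=> h1 h2; apply: measure_prod_unique => [|A B mA mB].
  exact: probability_lty.
by rewrite /= !product_measure1E//; congr (_ * _)%E; [exact: h1|exact: h2].
Qed.

End Products.

Definition mk_RV {R : realType} d d' (T : measurableType d)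
    (T' : measurableType d') (P : probability T R) (f : T -> T')
    (mf : measurable_fun setT f) : {RV P >-> T'} :=
  MeasurableFun.Pack (MeasurableFun.Class (isMeasurableFun.Build _ _ _ _ f mf)).

Section Independence.
Context {R : realType} d d' (T : measurableType d) (T' : measurableType d').
Context (P : probability T R) (I : eqType) (X : I -> {RV P >-> T'}).

(** These events form the pi-system that generates the sigma-algebra of the [X i] with [J i]. *)
Definition cylinder (J : pred I) (E : set T) := exists s A,
  [/\ uniq s, all J s, (forall i, measurable (A i))
    & E = \bigcap_(i in [set` s]) (X i @^-1` A i)].

Lemma cylinder_measurable J E : cylinder J E -> measurable E.
Proof.
move=> [s [A [_ _ mA ->]]]; apply: fin_bigcap_measurable => //.
by move=> i _; rewrite -[X in measurable X]setTI; exact: measurable_funPT.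
Qed.

Lemma cylinder_setT J : cylinder J setT.
Proof.
exists [::], (fun=> setT); split => //.
by apply/seteqP; split => t // _ i.
Qed.

Lemma cylinder_sub (J J' : pred I) E :
  subpred J' J -> cylinder J' E -> cylinder J E.
Proof. by move=> JJ' [s [A [us sJ mA EA]]]; exists s, A; split => //;
  exact: sub_all sJ. Qed.

Hypothesis Xindep : mutually_independent X.

(** As [i] is absent from the index list [s] of [E], the list [i :: s] is still duplicate-free.
    Mutual independence for [i :: s] and for [s] then splits off the factor of [i]. *)
Lemma cylinder_cons (J : pred I) i B E : J i -> measurable B ->
  cylinder (predD1 J i) E ->
  cylinder J (X i @^-1` B `&` E) /\
  P (X i @^-1` B `&` E) = (P (X i @^-1` B) * P E)%E.
Proof.
move=> Ji mB [s [A [us sJ mA ->]]].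
have nis : i \notin s by apply/negP => /(allP sJ) /=; rewrite eqxx.
(* [A i] does not occur in [E], so it can be overwritten by [B]. *)
pose A' j := if j == i then B else A j.
have mA' j : measurable (A' j) by rewrite /A'; case: ifP.
have neq j : j \in s -> (j == i) = false.
  by move=> js; apply: contraNF nis => /eqP <-.
have e : X i @^-1` B `&` \bigcap_(j in [set` s]) (X j @^-1` A j) =
    \bigcap_(j in [set` i :: s]) (X j @^-1` A' j).
  apply/seteqP; split=> [t [Xi Xs] j /=|t h].
    rewrite inE => /predU1P[->|js]; first by rewrite /A' eqxx.
    by rewrite /A' neq//; exact: Xs.
  split=> [|j js].
    by have := h i; rewrite /A' /= eqxx; apply; rewrite inE eqxx.
  by have := h j; rewrite /A' neq//; apply; rewrite /= inE js orbT.
have us' : uniq (i :: s) by rewrite /= nis.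
split.
  exists (i :: s), A'; split => //=; rewrite Ji /=.
  by apply: sub_all sJ => j /andP[].
rewrite e Xindep// Xindep// big_cons {1}/A' eqxx; congr (_ * _)%E.
by rewrite big_seq [RHS]big_seq; apply: eq_bigr => j js; rewrite /A' neq.
Qed.

(* Independence of [W] and of the sigma-algebra generated by the [X i], [J i],
   tested on a pi-system. *)
Definition indep_of d1 (T1 : measurableType d1) (W : {RV P >-> T1})
    (J : pred I) := forall D E, measurable D -> cylinder J E ->
  P (W @^-1` D `&` E) = (P (W @^-1` D) * P E)%E.

Lemma indep_of_sub d1 (T1 : measurableType d1) (W : {RV P >-> T1})
    (J J' : pred I) :
  subpred J' J -> indep_of W J -> indep_of W J'.
Proof. by move=> JJ' WJ D E mD /(cylinder_sub JJ') EJ; exact: WJ. Qed.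

Lemma indep_of_comp d1 d2 (T1 : measurableType d1) (T2 : measurableType d2)
    (W : {RV P >-> T1}) (g : T1 -> T2) (V : {RV P >-> T2}) J :
  measurable_fun setT g -> (V : T -> T2) = g \o W -> indep_of W J -> indep_of V J.
Proof.
move=> mg VgW WJ D E mD EJ.
have mgD : measurable (g @^-1` D) by rewrite -[X in measurable X]setTI; exact: mg.
by rewrite VgW comp_preimage WJ.
Qed.

Lemma indep_of_cst d1 (T1 : measurableType d1) (W : {RV P >-> T1}) c J :
  (W : T -> T1) = cst c -> indep_of W J.
Proof.
move=> Wc D E mD EJ; rewrite Wc preimage_cst; case: ifPn => _.
  by rewrite setTI probability_setT mul1e.
by rewrite set0I measure0 mul0e.
Qed.

Section Pair.
Context d1 (T1 : measurableType d1) (W : {RV P >-> T1}) (J : pred I) (i : I).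
Variable V : {RV P >-> (T1 * T')%type}.
Hypotheses (VE : (V : T -> T1 * T') = (fun t => (W t, X i t)))
  (WJ : indep_of W J) (Ji : J i).

Let preimX A B : V @^-1` (A `*` B) = W @^-1` A `&` X i @^-1` B.
Proof. by rewrite VE. Qed.

Lemma indep_of_pair_law :
  same_law (distribution P V) (distribution P W \x distribution P (X i))%E.
Proof.
apply: measure_prod_unique => [|A B mA mB].
  exact: probability_lty.
rewrite /= product_measure1E// /distribution /pushforward preimX.
have [+ _] := cylinder_cons Ji mB (cylinder_setT _).
by rewrite setIT; exact: WJ.
Qed.

(** For a fixed cylinder [E], the measures sending [D] to the probability of [E] with [V] in [D],
    and to the product of the two probabilities, agree on rectangles, hence everywhere. The index
    [i], now part of [V], leaves the family. *)
Lemma indep_of_pair : indep_of V (predD1 J i).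
Proof.
move=> D E mD EJ.
have mE := cylinder_measurable EJ.
pose c := NngNum (fine_ge0 (measure_ge0 P E)).
have cE : c%:num%:E = P E by rewrite fineK// fin_num_measure.
have : pushforward (mrestr P mE) V D = mscale c (distribution P V) D.
  apply: measure_prod_unique => //.
    by rewrite /= /pushforward /mrestr preimage_setT setTI -ge0_fin_numE//
      fin_num_measure.
  move=> A B mA mB.
  change (P (V @^-1` (A `*` B) `&` E) =
    (c%:num%:E * P (V @^-1` (A `*` B)))%E).
  rewrite preimX cE.
  have [XEJ XE] := cylinder_cons Ji mB EJ.
  have [+ _] := cylinder_cons Ji mB (cylinder_setT _).
  rewrite setIT => XJ.
  by rewrite -setIA WJ// XE WJ// muleA muleC.
rewrite /pushforward /mrestr /mscale /distribution /pushforward cE => ->.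
by rewrite muleC.
Qed.

End Pair.
End Independence.

(** * The resolvent kernel *)

Section Resolvent.
Context {R : realType}.

Definition resolvent (z : R[i]) (w : R) : R[i] := ((w%:C)%C - z)^-1.

(** Real and imaginary parts of 1 / (u - i eta): up to a factor pi, the conjugate Poisson kernel and
    the Poisson kernel of the half-plane. *)
Definition poisson_re (eta u : R) := u / (u ^+ 2 + eta ^+ 2).
Definition poisson_im (eta u : R) := eta / (u ^+ 2 + eta ^+ 2).

Lemma Re_resolvent z w :
  complex.Re (resolvent z w) = poisson_re (complex.Im z) (w - complex.Re z).
Proof. by case: z => a b; rewrite /resolvent /poisson_re /= sub0r sqrrN. Qed.

Lemma Im_resolvent z w :
  complex.Im (resolvent z w) = poisson_im (complex.Im z) (w - complex.Re z).
Proof. by case: z => a b;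
  rewrite /resolvent /poisson_im /= sub0r sqrrN mulNr opprK. Qed.

Section PositiveHeight.
Variable eta : R.
Hypothesis eta0 : 0 < eta.

Lemma poisson_den_gt0 u : 0 < u ^+ 2 + eta ^+ 2.
Proof. by rewrite ltr_wpDl ?sqr_ge0 ?exprn_gt0. Qed.

Let den_neq0 u : u ^+ 2 + eta ^+ 2 != 0.
Proof. by rewrite gt_eqF// poisson_den_gt0. Qed.

Lemma is_derive_poisson_den_inv u :
  is_derive (u : R) (1 : R) (fun u : R => (u ^+ 2 + eta ^+ 2)^-1)
    (- (2 * u) / (u ^+ 2 + eta ^+ 2) ^+ 2).
Proof.
have dq : is_derive (u : R) (1 : R) (fun u : R => u ^+ 2 + eta ^+ 2) (2 * u).
  by apply: is_derive_eq; rewrite /GRing.scale/=; ring.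
have /is_derive_eq := is_deriveV (f := fun u : R =>
  u ^+ 2 + eta ^+ 2) (den_neq0 u) dq.
apply.
by rewrite /GRing.scale/=; field; exact: den_neq0.
Qed.

Lemma is_derive_poisson_re u :
  is_derive (u : R) (1 : R) (poisson_re eta)
    ((eta ^+ 2 - u ^+ 2) / (u ^+ 2 + eta ^+ 2) ^+ 2).
Proof.
have /is_derive_eq := is_deriveM (is_derive_id u (1 :
  R)) (is_derive_poisson_den_inv u).
apply.
by rewrite /GRing.scale/=; field; exact: den_neq0.
Qed.

Lemma is_derive_poisson_im u :
  is_derive (u : R) (1 : R) (poisson_im eta)
    (- (2 * u * eta) / (u ^+ 2 + eta ^+ 2) ^+ 2).
Proof.
have /is_derive_eq :=
  is_deriveM (is_derive_cst eta u (1 : R)) (is_derive_poisson_den_inv u).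
apply.
by rewrite /GRing.scale/=; field; exact: den_neq0.
Qed.

Lemma normr_poisson_im u : `|poisson_im eta u| <= eta^-1.
Proof.
rewrite ger0_norm; last by rewrite divr_ge0// ltW// poisson_den_gt0.
rewrite ler_pdivrMr ?poisson_den_gt0// mulrDr -[eta^-1 * eta ^+ 2]mulrC expr2
  mulfK ?gt_eqF//.
by rewrite lerDr mulr_ge0 ?sqr_ge0// invr_ge0 ltW.
Qed.

(** This is eta |u| <= u^2 + eta^2, a consequence of (|u| - eta)^2 >= 0. *)
Lemma normr_poisson_re u : `|poisson_re eta u| <= eta^-1.
Proof.
rewrite normrM normfV [X in _ / X]gtr0_norm ?poisson_den_gt0//.
rewrite ler_pdivrMr ?poisson_den_gt0// ler_pdivlMl//.
rewrite -[u ^+ 2]real_normK ?num_real//.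
by have := sqr_ge0 (`|u| - eta); have := sqr_ge0 `|u|; have := sqr_ge0 eta; nra.
Qed.

End PositiveHeight.
End Resolvent.

(** * Averaging the squared resolvent over a uniform weight *)

Section ResolventExpectation.
Context {R : realType}.

Lemma is_derive1_continuous (f f' : R -> R) :
  (forall u : R, is_derive u (1 : R) f (f' u)) -> continuous f.
Proof. by move=> df u; apply/differentiable_continuous/derivable1_diffP;
  case: (df u). Qed.

Lemma continuous_poisson_re (eta : R) : 0 < eta -> continuous (poisson_re eta).
Proof. by move=> eta0;
  exact: is_derive1_continuous (is_derive_poisson_re eta0). Qed.

Lemma continuous_poisson_im (eta : R) : 0 < eta -> continuous (poisson_im eta).
Proof. by move=> eta0;
  exact: is_derive1_continuous (is_derive_poisson_im eta0). Qed.

Lemma bounded_cmfun_resolvent (z : R[i]) : 0 < complex.Im z ->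
  bounded_cmfun (resolvent z).
Proof.
move=> z0.
have msub : measurable_fun setT (fun w : R =>
  w - complex.Re z) by exact: measurable_funB.
split.
  under eq_fun do rewrite Re_resolvent.
  apply: (bounded_mfun_comp (f := poisson_re _) msub); split.
    by apply: continuous_measurable_fun; exact: continuous_poisson_re.
  by exists (complex.Im z)^-1 => x; exact: normr_poisson_re.
under eq_fun do rewrite Im_resolvent.
apply: (bounded_mfun_comp (f := poisson_im _) msub); split.
  by apply: continuous_measurable_fun; exact: continuous_poisson_im.
by exists (complex.Im z)^-1 => x; exact: normr_poisson_im.
Qed.

Lemma Rintegral_uniform01 (f F : R -> R) : continuous f ->
  (forall y : R, is_derive y (1 : R) F (f y)) ->
  \int[uniform_prob (@ltr01 R)]_y f y = F 1 - F 0.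
Proof.
move=> cf dF; rewrite /Rintegral.
have mf : measurable_fun setT (EFin \o f).
  by apply/measurable_EFinP; exact: continuous_measurable_fun.
(* Positive and negative parts are compared separately; the normalizing factor of the uniform law is
   1 / (1 - 0) = 1. *)
have -> : (\int[uniform_prob (@ltr01 R)]_y (f y)%:E =
    \int[lebesgue_measure]_(y in `[0%R, 1%R]) (f y)%:E)%E.
  rewrite [LHS]integralE [RHS]integralE !integral_uniform//.
  - by rewrite subr0 invr1 !mul1e.
  - exact: measurable_funeneg.
  - exact: measurable_funepos.
have cfw : {within `[0, 1], continuous f} by exact: continuous_subspaceT.
have dFw : derivable_oo_LRcontinuous F 0 1.
  split=> [y _||]; first by case: (dF y).
    by apply: cvg_at_right_filter; exact: is_derive1_continuous dF _.
  by apply: cvg_at_left_filter; exact: is_derive1_continuous dF _.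
have dFE : {in `]0, 1[, derive1 F =1 f} by move=> y _; rewrite derive1E;
  case: (dF y).
by rewrite (continuous_FTC2 ltr01 cfw dFw dFE).
Qed.

Lemma measurable_idTR :
  measurable_fun setT (idfun : measurableTypeR R -> R).
Proof. by move=> _ A mA; rewrite setTI. Qed.

(* [uniform_prob] lives on [measurableTypeR R], whose display differs from
   that of [R]. *)
Definition uniform01 : probability R R :=
  distribution (uniform_prob (@ltr01 R)) (mk_RV (uniform_prob (@ltr01 R))
    measurable_idTR).

(** The fundamental theorem of calculus is applied to each part of an antiderivative that vanishes
    at y = 0 and equals 1 / ((x - z) (b - z)) at y = 1. *)
Lemma cexpect_uniform_resolvent (z : R[i]) (x b : R) : 0 < complex.Im z ->
  cexpect uniform01 (fun y =>
    resolvent z (y * b + (1 - y) * x) * resolvent z (y * b + (1 - y) * x)) =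
  resolvent z x * resolvent z b.
Proof.
move=> z0; set eta := complex.Im z; set xi := complex.Re z.
pose u y : R := y * b + (1 - y) * x - xi.
(* Multiplication by the constant 1 / (x - z) = c0 + i s0 produces the coefficients (c0, - s0) of
   the real part and (s0, c0) of the imaginary part, used as [(k, l)] in [dF]. *)
pose c0 := complex.Re (resolvent z x); pose s0 := complex.Im (resolvent z x).
have nz v : v ^+ 2 + eta ^+ 2 != 0 by rewrite gt_eqF// poisson_den_gt0.
have du (y : R) : is_derive y (1 : R) u (b - x).
  have -> : u = fun y => y * (b - x) + (x - xi) by apply/funext => v;
    rewrite /u; ring.
  by apply: is_derive_eq; rewrite /GRing.scale/=; ring.
have u1 : u 1 = b - xi by rewrite /u; ring.
have dre (y : R) := is_derive1_comp (is_derive_poisson_re z0 (u y)) (du y).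
have dim (y : R) := is_derive1_comp (is_derive_poisson_im z0 (u y)) (du y).
have cu : continuous u by exact: is_derive1_continuous du.
have cre : continuous (poisson_re eta \o u) by exact: is_derive1_continuous dre.
have cim : continuous (poisson_im eta \o u) by exact: is_derive1_continuous dim.
(* For [p = x - z] and [q = b - z], [y / (p * (p + y * (q - p)))] is an
   antiderivative of [1 / (p + y * (q - p)) ^+ 2], including when [p = q]. *)
have dF (k l y : R) :
    is_derive y (1 : R) (fun y =>
      y * (k * poisson_re eta (u y) + l * poisson_im eta (u y)))
     ((k * poisson_re eta (u y) + l * poisson_im eta (u y)) +
      y * (k * ((eta ^+ 2 - u y ^+ 2) / (u y ^+ 2 + eta ^+ 2) ^+ 2 * (b - x)) +
           l * (- (2 * u y * eta) / (u y ^+ 2 + eta ^+ 2) ^+ 2 * (b - x)))).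
  have d1 := is_deriveM (is_derive_cst k y (1 : R)) (dre y).
  have d2 := is_deriveM (is_derive_cst l y (1 : R)) (dim y).
  have /is_derive_eq := is_deriveM (is_derive_id y (1 : R)) (is_deriveD d1 d2).
  by apply; rewrite ?fctE /GRing.scale/= -/eta; ring.
have br := bounded_cmfun_resolvent z0.
have mu : measurable_fun setT (fun y : R => y * b + (1 - y) * x).
  by apply: measurable_funD; apply: measurable_funM => //; apply: measurable_funB.
rewrite cexpect_distribution;
  last exact: (bounded_cmfun_comp mu (bounded_cmfunM br br)).
apply/eqP; rewrite eq_complex; apply/andP; split; apply/eqP;
  rewrite !complex_partsE /=.
- under eq_Rintegral do rewrite complex_partsE !Re_resolvent !Im_resolvent -/xi
    -/(u _) -/eta.
  pose f y := poisson_re eta (u y) * poisson_re eta (u y) -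
    poisson_im eta (u y) * poisson_im eta (u y).
  pose F y := y * (c0 * poisson_re eta (u y) + (- s0) * poisson_im eta (u y)).
  have cf : continuous f.
    by move=> y; apply: cvgB; apply: cvgM;
      [exact: cre|exact: cre|exact: cim|exact: cim].
  have dFf (y : R) : is_derive y (1 : R) F (f y).
    have /is_derive_eq := dF c0 (- s0) y; apply.
    rewrite /f /c0 /s0 !Re_resolvent !Im_resolvent -/eta -/xi /poisson_re
      /poisson_im.
    have := nz (u y); have := nz (x - xi); rewrite /u => h1 h2.
    by field; apply/andP; split; [exact: h2|exact: h1].
  rewrite (Rintegral_uniform01 cf dFf) /F.
  by rewrite mul0r subr0 u1 /c0 /s0 !Re_resolvent !Im_resolvent -/eta -/xi; ring.
- under eq_Rintegral do rewrite complex_partsE !Re_resolvent !Im_resolvent -/xi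
    -/(u _) -/eta.
  pose f y := poisson_re eta (u y) * poisson_im eta (u y) +
    poisson_im eta (u y) * poisson_re eta (u y).
  pose F y := y * (s0 * poisson_re eta (u y) + c0 * poisson_im eta (u y)).
  have cf : continuous f.
    by move=> y; apply: cvgD; apply: cvgM;
      [exact: cre|exact: cim|exact: cim|exact: cre].
  have dFf (y : R) : is_derive y (1 : R) F (f y).
    have /is_derive_eq := dF s0 c0 y; apply.
    rewrite /f /c0 /s0 !Re_resolvent !Im_resolvent -/eta -/xi /poisson_re
      /poisson_im.
    have := nz (u y); have := nz (x - xi); rewrite /u => h1 h2.
    by field; apply/andP; split; [exact: h2|exact: h1].
  rewrite (Rintegral_uniform01 cf dFf) /F.
  by rewrite mul0r subr0 u1 /c0 /s0 !Re_resolvent !Im_resolvent -/eta -/xi; ring.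
Qed.

End ResolventExpectation.

Lemma same_law_refl {R : realType} d (T : measurableType d)
    (m : set T -> \bar R) : same_law m m.
Proof. by []. Qed.

Lemma same_law_trans {R : realType} d (T : measurableType d)
    (m1 m2 m3 : set T -> \bar R) :
  same_law m1 m2 -> same_law m2 m3 -> same_law m1 m3.
Proof. by move=> h12 h23 A mA; rewrite h12// h23. Qed.

(** * The stick-breaking series *)

(** Horner form of the sum of the first [N] terms built from the sequences shifted by [m]. Unfolding
    from the front makes the recursion X = Y B + (1 - Y) X' hold by computation. *)
Fixpoint stick_sum {R : realType} (y b : nat -> R) (m N : nat) : R :=
  if N is N'.+1 then y m * b m + (1 - y m) * stick_sum y b m.+1 N' else 0.

Lemma stick_sumE {R : realType} (y b : nat -> R) m N :
  stick_sum y b m N =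
  \sum_(k < N) y (m + k)%N * (\prod_(j < k) (1 - y (m + j)%N)) * b (m + k)%N.
Proof.
elim: N m => [|N IH] m /=; first by rewrite big_ord0.
rewrite big_ord_recl /= big_ord0 mulr1 addn0 IH; congr (_ + _).
rewrite mulr_sumr; apply: eq_bigr => k _.
rewrite big_ord_recl /= addn0 /bump /= add1n addnS -addSn.
under [in RHS]eq_bigr do rewrite /bump /= add1n addnS -addSn.
by rewrite !mulrA [(1 - y m) * _]mulrC.
Qed.

Lemma series_stick_weight {R : realType} (y b : nat -> R) N :
  series (fun k => stick_weight y k * b k) N = stick_sum y b 0 N.
Proof. by rewrite stick_sumE seriesEord. Qed.

Section StickSums.
Context {R : realType} d (T : measurableType d) (P : probability T R).
Context (B Y : nat -> {RV P >-> R}).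
Context (alpha : probability R R).

Let X (i : nat + nat) := match i with inl k => B k | inr k => Y k end.
Let index (i : nat + nat) := match i with inl k => k | inr k => k end.
Let before m : pred (nat + nat) := [pred i | index i < m]%N.

Definition stick_partial m N (t : T) : R :=
  stick_sum (fun j => Y j t) (fun j => B j t) m N.

Lemma measurable_stick_partial m N : measurable_fun setT (stick_partial m N).
Proof.
elim: N m => [|N IH] m; rewrite /stick_partial/=; first exact: measurable_cst.
apply: measurable_funD; apply: measurable_funM => //.
  by apply: measurable_funB.
exact: IH.
Qed.

Definition stick_RV m N : {RV P >-> R} := mk_RV P (measurable_stick_partial m N).

Hypothesis Xindep : mutually_independent X.
Hypothesis Blaw : forall k, same_law (distribution P (B k)) alpha.
Hypothesis Ylaw : forall k,
  same_law (distribution P (Y k)) (uniform_prob (@ltr01 R)).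

Let triple m N (t : T) : (R * R) * R := ((stick_RV m.+1 N t, B m t), Y m t).

Let mtriple m N : measurable_fun setT (triple m N).
Proof. by do 2 (apply: measurable_fun_pair => //). Qed.

Let mpair m N : measurable_fun setT (fun t => (stick_RV m.+1 N t, B m t)).
Proof. exact: measurable_fun_pair. Qed.

(** One step of stick breaking: [stick_partial m N.+1] is convertible to [blend] composed with
    [triple m N]. *)
Let blend (p : (R * R) * R) : R := p.2 * p.1.2 + (1 - p.2) * p.1.1.

Let mblend : measurable_fun setT blend.
Proof.
apply: measurable_funD; apply: measurable_funM => //.
- by apply: measurableT_comp.
- by apply: measurable_funB.
- by apply: measurableT_comp.
Qed.

(** Only variables of index at least [m] enter the sum. In the induction the tail from [m.+1] is
    independent of all indices up to [m]; adjoining [B m] and then [Y m] uses up exactly the two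
    variables of index [m]. *)
Lemma stick_RV_indep m N : indep_of X (stick_RV m N) (before m).
Proof.
elim: N m => [|N IH] m;
  first by refine (@indep_of_cst _ _ _ _ _ _ _ _ _ _ (stick_RV m 0) (0 : R) _ _).
have i1 : indep_of X (mk_RV P (mpair m N)) (predD1 (before m.+1) (inl m)).
  by apply: (indep_of_pair Xindep (W := stick_RV m.+1 N)) => //=; exact: ltnSn.
have i2 : indep_of X (mk_RV P (mtriple m N))
    (predD1 (predD1 (before m.+1) (inl m)) (inr m)).
  apply: (indep_of_pair Xindep (W := mk_RV P (mpair m N))) => //=; exact: ltnSn.
apply: (indep_of_comp (W := mk_RV P (mtriple m N)) (g := blend)) => //.
apply: indep_of_sub i2 => -[k|k]; rewrite /before/= => km; rewrite ltnW// andbT;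
  by apply: contraTneq km => -[->]; rewrite ltnn.
Qed.

(** Tail, atom and weight are independent: [B m] is adjoined to the tail, then [Y m] to the pair,
    and each marginal is replaced by its prescribed law. *)
Let triple_law m N : same_law (distribution P (mk_RV P (mtriple m N)))
  ((distribution P (stick_RV m.+1 N) \x alpha) \x uniform01)%E.
Proof.
have l1 : same_law (distribution P (mk_RV P (mpair m N)))
    (distribution P (stick_RV m.+1 N) \x distribution P (B m))%E.
  by apply: (indep_of_pair_law Xindep (i :=
    inl m) _ (@stick_RV_indep m.+1 N)) => //=; exact: ltnSn.
have i1 : indep_of X (mk_RV P (mpair m N)) (predD1 (before m.+1) (inl m)).
  by apply: (indep_of_pair Xindep (W := stick_RV m.+1 N)) => //=;
    [exact: stick_RV_indep|exact: ltnSn].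
have l2 : same_law (distribution P (mk_RV P (mtriple m N)))
    (distribution P (mk_RV P (mpair m N)) \x distribution P (Y m))%E.
  by apply: (indep_of_pair_law Xindep (i := inr m) _ i1) => //=; exact: ltnSn.
have l3 := same_law_prod (same_law_refl (distribution P (stick_RV m.+1 N)))
  (Blaw m).
have l4 : same_law (distribution P (mk_RV P (mpair m N)))
    (distribution P (stick_RV m.+1 N) \x alpha)%E.
  exact: (same_law_trans l1 l3).
pose PP : probability (R * R)%type R :=
  (distribution P (stick_RV m.+1 N) \x alpha)%E.
have l5 := @same_law_prod _ _ _ _ _ (distribution P (mk_RV P (mpair m N))) PP
  (distribution P (Y m)) uniform01 l4 (Ylaw m).
exact: (same_law_trans l2 l5).
Qed.

(** The law of the tail determines that of the triple, hence that of the blend, so by induction the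
    offset is immaterial. This is what makes the tail from 1 a copy of the partial sum from 0. *)
Lemma stick_RV_law m m' N :
  same_law (distribution P (stick_RV m N)) (distribution P (stick_RV m' N)).
Proof.
elim: N m m' => [|N IH] m m' D mD //.
have mbD : measurable (blend @^-1` D) by rewrite -[X in measurable X]setTI;
  exact: mblend.
transitivity (distribution P (mk_RV P (mtriple m N)) (blend @^-1` D)) => //.
transitivity (distribution P (mk_RV P (mtriple m' N)) (blend @^-1` D)) => //.
have l := same_law_prod (IH m.+1 m'.+1) (same_law_refl alpha).
have l' := same_law_prod l (same_law_refl uniform01).
by rewrite !triple_law//; exact: l'.
Qed.

Lemma cexpect_stick_resolvent_sq (z : R[i]) N : 0 < complex.Im z ->
  cexpect P (fun t =>
    resolvent z (stick_partial 0 N.+1 t) * resolvent z (stick_partial 0 N.+1 t)) =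
  cexpect alpha (resolvent z) * cexpect P (fun t =>
    resolvent z (stick_partial 0 N t)).
Proof.
move=> z0; have br := bounded_cmfun_resolvent z0.
have brr := bounded_cmfunM br br.
transitivity (cexpect (distribution P (mk_RV P (mtriple 0 N)))
   (fun p => resolvent z (blend p) * resolvent z (blend p))).
  by rewrite cexpect_distribution//; exact: (bounded_cmfun_comp mblend brr).
rewrite (cexpect_same_law _ (@triple_law 0 N)).
rewrite cexpect_prod; last exact: (bounded_cmfun_comp mblend brr).
(* The weight is the innermost variable: it is averaged first, for a fixed tail [p.1] and atom
   [p.2], and leaves a product of a function of each. *)
under [X in cexpect _ X]eq_fun => p.
  rewrite (_ : cexpect _ _ = resolvent z p.1 * resolvent z p.2);
    last exact: cexpect_uniform_resolvent.
  over.
rewrite cexpect_prod; last first.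
  by apply: bounded_cmfunM;
    [exact: (bounded_cmfun_comp measurable_fst br)|exact: (bounded_cmfun_comp
      measurable_snd br)].
under [X in cexpect _ X]eq_fun do rewrite /= cexpectZl//.
rewrite cexpectZr// mulrC (cexpect_same_law _ (@stick_RV_law 1 0 N)).
by rewrite cexpect_distribution.
Qed.

End StickSums.

(** * Limits of expectations of bounded functions *)

Section BoundedConvergence.
Context {R : realType} d (T : measurableType d) (P : probability T R).

(** Dominated convergence, with the constant [M] as dominating function. *)
Lemma cvg_Rintegral_bounded (f : (T -> R)^nat) (g : T -> R) (M : R) :
  (forall n, measurable_fun setT (f n)) -> measurable_fun setT g ->
  (forall n t, `|f n t| <= M) -> {ae P, forall t, f ^~ t @ \oo --> g t} ->
  \int[P]_t f n t @[n --> \oo] --> \int[P]_t g t.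
Proof.
move=> mf mg fM fg.
have [| | | | |ig _ +] := @dominated_convergence _ _ _ P setT measurableT
    (fun n => EFin \o f n) (EFin \o g) (cst M%:E).
- by move=> n; exact/measurable_EFinP.
- exact/measurable_EFinP.
- apply: filterS fg => t ft _; apply: cvg_EFin; first exact: nearW.
  exact: ft.
- exact: finite_measure_integrable_cst.
- by apply: aeW => t n _ /=; rewrite lee_fin.
by move=> h; apply: fine_cvg; rewrite fineK// integrable_fin_num.
Qed.

Lemma cvg_Rintegral_comp (g : R -> R) (X : {RV P >-> R}^nat) (Z : {RV P >-> R}) :
  continuous g -> bounded_mfun g -> {ae P, forall t, X ^~ t @ \oo --> Z t} ->
  \int[P]_t g (X n t) @[n --> \oo] --> \int[P]_t g (Z t).
Proof.
move=> cg [mg [M gM]] XZ.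
apply: (@cvg_Rintegral_bounded (fun n => g \o X n) (g \o Z) M) => //.
- by move=> n; exact: measurableT_comp.
- exact: measurableT_comp.
- by move=> n t; exact: gM.
- by apply: filterS XZ => t Xt; exact: cvg_comp Xt (cg (Z t)).
Qed.

Lemma cvg_Re_cexpect_comp (g : R ->
  R[i]) (X : {RV P >-> R}^nat) (Z : {RV P >-> R}) :
  continuous (fun w => complex.Re (g w)) -> bounded_cmfun g ->
  {ae P, forall t, X ^~ t @ \oo --> Z t} ->
  complex.Re (cexpect P (g \o X n)) @[n --> \oo] -->
    complex.Re (cexpect P (g \o Z)).
Proof. by move=> cg [bg _];
  exact: (cvg_Rintegral_comp (g := fun w => complex.Re (g w))). Qed.

Lemma cvg_Im_cexpect_comp (g : R ->
  R[i]) (X : {RV P >-> R}^nat) (Z : {RV P >-> R}) :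
  continuous (fun w => complex.Im (g w)) -> bounded_cmfun g ->
  {ae P, forall t, X ^~ t @ \oo --> Z t} ->
  complex.Im (cexpect P (g \o X n)) @[n --> \oo] -->
    complex.Im (cexpect P (g \o Z)).
Proof. by move=> cg [_ bg];
  exact: (cvg_Rintegral_comp (g := fun w => complex.Im (g w))). Qed.

End BoundedConvergence.

Lemma is_mu_resolvent_sq {R : realType} (alpha nu : probability R R) (z : R[i]) :
  is_mu alpha nu -> 0 < complex.Im z ->
  cexpect nu (fun w => resolvent z w * resolvent z w) =
  cexpect alpha (resolvent z) * cexpect nu (resolvent z).
Proof.
move=> [d [T [P [B [Y [X [ind Blaw Ylaw Xlim Xlaw]]]]]]] z0.
have br := bounded_cmfun_resolvent z0; have brr := bounded_cmfunM br br.
rewrite -!(cexpect_same_law _ Xlaw) !cexpect_distribution//.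
pose S n := stick_RV B Y 0 n.
have SX : {ae P, forall t, S ^~ t @ \oo --> X t}.
  apply: filterS Xlim => t; rewrite (_ : series _ = S ^~ t)//.
  by apply/funext => n; rewrite series_stick_weight.
(* The finite identity has [S n.+1] on the left and [S n] on the right; both converge to [X], and
   uniqueness of limits concludes. *)
have SX1 : {ae P, forall t, (fun n => S n.+1 t) @ \oo --> X t}.
  by apply: filterS SX => t; rewrite -(cvg_shiftS (S ^~ t)).
have cRe : continuous (fun w => complex.Re (resolvent z w)).
  under eq_fun do rewrite Re_resolvent.
  by move=> w; apply: (@continuous_comp _ _ _ (fun w =>
    w - complex.Re z) (poisson_re _) w);
    [by apply: cvgB; [exact: cvg_id|exact: cvg_cst]|exact: continuous_poisson_re].
have cIm : continuous (fun w => complex.Im (resolvent z w)).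
  under eq_fun do rewrite Im_resolvent.
  by move=> w; apply: (@continuous_comp _ _ _ (fun w =>
    w - complex.Re z) (poisson_im _) w);
    [by apply: cvgB; [exact: cvg_id|exact: cvg_cst]|exact: continuous_poisson_im].
have key n := cexpect_stick_resolvent_sq ind Blaw Ylaw n z0.
set c := cexpect alpha _.
have eRe := cvg_Re_cexpect_comp cRe br SX.
have eIm := cvg_Im_cexpect_comp cIm br SX.
have e2Re := cvg_Re_cexpect_comp
  (g := fun w => resolvent z w * resolvent z w) _ brr SX1.
have e2Im := cvg_Im_cexpect_comp
  (g := fun w => resolvent z w * resolvent z w) _ brr SX1.
have key' n : cexpect P ((fun w => resolvent z w * resolvent z w) \o S n.+1) =
  c * cexpect P (resolvent z \o S n) by exact: key.
have cRe2 : continuous (fun w => complex.Re (resolvent z w * resolvent z w)).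
  under eq_fun do rewrite complex_partsE.
  by move=> w; apply: cvgB; apply: cvgM;
    [exact: cRe|exact: cRe|exact: cIm|exact: cIm].
have cIm2 : continuous (fun w => complex.Im (resolvent z w * resolvent z w)).
  under eq_fun do rewrite complex_partsE.
  by move=> w; apply: cvgD; apply: cvgM;
    [exact: cRe|exact: cIm|exact: cIm|exact: cRe].
have {}e2Re := e2Re cRe2; have {}e2Im := e2Im cIm2.
apply/eqP; rewrite eq_complex; apply/andP; split; apply/eqP; rewrite complex_partsE.
  apply: (cvg_unique _ e2Re); first exact: norm_hausdorff.
  rewrite /mkset/=.
  rewrite (eq_cvg _ _ (fun n => congr1 (@complex.Re R) (key' n))).
  under eq_fun do rewrite complex_partsE.
  by apply: cvgB; apply: cvgM; (exact: cvg_cst || exact: eRe || exact: eIm).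
apply: (cvg_unique _ e2Im); first exact: norm_hausdorff.
  rewrite /mkset/=.
rewrite (eq_cvg _ _ (fun n => congr1 (@complex.Im R) (key' n))).
under eq_fun do rewrite complex_partsE.
by apply: cvgD; apply: cvgM; (exact: cvg_cst || exact: eRe || exact: eIm).
Qed.

(** * The Cauchy transform *)

Section CauchyTransform.
Context {R : realType}.

Lemma cauchy_transformE (nu : probability R R) (z : R[i]) :
  cauchy_transform nu z = cexpect nu (resolvent z).
Proof. by []. Qed.

Lemma norm_resolvent_le (z : R[i]) (e w : R) : 0 < e -> e <= complex.Im z ->
  `|resolvent z w| <= (2 / e)%:C%C.
Proof.
move=> e0 ez; have z0 := lt_le_trans e0 ez.
have ei : (complex.Im z)^-1 <= e^-1 by rewrite lef_pV2.
by apply: norm_complex_le; rewrite ?Re_resolvent ?Im_resolvent;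
  apply: le_trans ei; [exact: normr_poisson_re|exact: normr_poisson_im].
Qed.

Lemma resolvent_den_neq0 (z : R[i]) (w : R) : 0 < complex.Im z -> (w%:C)%C - z != 0.
Proof.
move=> z0; rewrite subr_eq0; apply: contraTneq z0 => <- /=.
by rewrite ltxx.
Qed.

(** By the resolvent identity, [L] minus the difference quotient is exactly - h times the
    expectation of 1 / ((w - z)^2 (w - z - h)), and this expectation stays bounded for small h. *)
Lemma is_derive_cauchy_transform (nu : probability R R) (z : R[i]^o) :
  0 < complex.Im z ->
  is_derive z (1 : R[i]^o) (cauchy_transform nu)
    (cexpect nu (fun w => resolvent z w * resolvent z w)).
Proof.
move=> z0; set L := cexpect _ _.
have br := bounded_cmfun_resolvent z0.
set eta := complex.Im z in z0.
have eta2 : 0 < eta / 2 by rewrite divr_gt0.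
(* For |h| < eta / 2 both [z] and [h + z] have height at least eta / 2, so [k] bounds the three
   resolvents; the 2 in [M] comes from [norm_cexpect_le]. *)
pose k := 2 / (eta / 2).
pose M : R := 2 * (k * k * k).
have M0 : 0 < M by rewrite /M; do ?apply: mulr_gt0; rewrite ?invr_gt0.
have est (h : R[i]) : h != 0 -> `|h| < (eta / 2)%:C%C ->
    `|L - h^-1 * (cauchy_transform nu (h + z) - cauchy_transform nu z)| <= `|h|
      * M%:C%C.
  move=> h0 hlt; rewrite !cauchy_transformE.
  have Imh : `|complex.Im h| <= eta / 2 by apply: normr_Im_le; exact: ltW.
  have Imzh : eta / 2 <= complex.Im (h + z).
    rewrite Im_addc -/eta; move: Imh; rewrite ler_norml => /andP[]; lra.
  have zh0 : 0 < complex.Im (h + z) by exact: lt_le_trans Imzh.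
  have brh := bounded_cmfun_resolvent zh0.
  have -> : L - h^-1 * (cexpect nu (resolvent (h + z)) - cexpect nu (resolvent z)) =
      - h * cexpect nu (fun w =>
          resolvent z w * resolvent z w * resolvent (h + z) w).
    rewrite -cexpectB// -cexpectZl; last exact: bounded_cmfunB.
    rewrite -cexpectB; last 2 first.
      exact: bounded_cmfunM.
      by apply: bounded_cmfunM; [exact: bounded_cmfun_cst|exact: bounded_cmfunB].
    rewrite -cexpectZl; last by do 2 (apply: bounded_cmfunM => //).
    congr cexpect; apply/funext => w; rewrite /resolvent.
    have := resolvent_den_neq0 w z0; have := resolvent_den_neq0 w zh0 => n1 n2.
    by field; rewrite n1 n2 h0.
  rewrite normrM normrN ler_wpM2l//; apply: norm_cexpect_le.
    by do 2 (apply: bounded_cmfunM => //).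
  move=> w; rewrite !normrM [leRHS]rmorphM rmorphM.
  have r1 : `|resolvent z w| <= k%:C%C.
    by apply: norm_resolvent_le => //; rewrite -/eta; lra.
  have r2 : `|resolvent (h + z) w| <= k%:C%C by exact: norm_resolvent_le.
  by rewrite ler_pM ?mulr_ge0// ler_pM.
have lim : (fun h : R[i]^o =>
  h^-1 *: (cauchy_transform nu (h *: (1 : R[i]^o) + z) - cauchy_transform nu z))
    @ 0^' --> (L : R[i]^o).
  apply/cvgrPdist_le => e e0; near=> h.
  have h0 : h != 0 by near: h; exact: nbhs_dnbhs_neq.
  rewrite /GRing.scale/= mulr1; apply: le_trans (est h h0 _) _.
    by near: h; apply: dnbhs0_lt; rewrite ltcR.
  rewrite -ler_pdivlMr ?ltcR//.
  by near: h; apply: dnbhs0_le; rewrite divr_gt0 ?ltcR.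
apply: DeriveDef; first by apply/cvg_ex; exists L.
exact: (cvg_lim _ lim).
Unshelve. all: by end_near. Qed.

Lemma is_mu_derive (alpha nu : probability R R) (z : R[i]^o) :
  is_mu alpha nu -> 0 < complex.Im z ->
  is_derive z (1 : R[i]^o) (cauchy_transform nu)
    (cauchy_transform alpha z * cauchy_transform nu z).
Proof.
move=> mu z0; rewrite !cauchy_transformE -(is_mu_resolvent_sq mu z0).
exact: is_derive_cauchy_transform.
Qed.

End CauchyTransform.

(** * Functions with zero derivative on the upper half-plane *)

Section HalfPlane.
Context {R : realType}.
Implicit Types (f : R[i]^o -> R[i]^o) (z d : R[i]).

(** The complex difference quotient is taken at the increment s d and multiplied by [d]. Since |d| =
    1, that increment has modulus |s| and the error is unchanged. *)
Lemma cvg_path_quotient f z d (L : R[i]) : `|d| = 1 ->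
  is_derive (z : R[i]^o) (1 : R[i]^o) f L ->
  forall e : R, 0 < e -> \forall s \near (0 : R)^',
    `|L * d - (s^-1)%:C%C * (f ((s%:C)%C * d + z) - f z)| <= e%:C%C.
Proof.
move=> d1 [df <-] e e0.
have d0 : d != 0 by rewrite -normr_eq0 d1 oner_eq0.
have eC : 0 < (e%:C)%C :> R[i] by rewrite ltcR.
have /cvgrPdist_le/(_ _ eC) := df.
rewrite near_withinE => /nbhs_normP[r /= r0 H].
(* The radius is a positive element of [R[i]], hence real, and can be compared with |s|. *)
have rE : r = (complex.Re r)%:C%C by rewrite RRe_real// gtr0_real.
have r0' : 0 < complex.Re r by rewrite -ltcR -rE.
near=> s.
have s0 : s != 0 by near: s; exact: nbhs_dnbhs_neq.
have sC0 : (s%:C)%C != 0 :> R[i] by rewrite -(inj_eq (@complexI R)) in s0.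
have sd0 : (s%:C)%C * d != 0 by rewrite mulf_neq0.
have nsd : `|(s%:C)%C * d| = `|s|%:C%C.
  by rewrite normrM d1 mulr1 normc_def /= expr0n /= addr0 sqrtr_sqr.
have : `|((s%:C)%C * d)^-1 * (f ((s%:C)%C * d + z) - f z) - 'D_1 f z| <= e%:C%C.
  have := H ((s%:C)%C * d); rewrite /= sub0r normrN nsd.
  rewrite /GRing.scale/= mulr1 distrC; apply => //.
  by rewrite rE ltcR; near: s; exact: dnbhs0_lt.
set D := f _ - f z; move=> le.
have -> : 'D_1 f z * d - (s^-1)%:C%C * D = ('D_1 f z - ((s%:C)%C * d)^-1 * D) * d.
  by rewrite fmorphV; field; rewrite d0 sC0.
by rewrite normrM d1 mulr1 distrC.
Unshelve. all: by end_near. Qed.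

Lemma is_derive_Re_path f z d (t : R) (L : R[i]) : `|d| = 1 ->
  is_derive ((t%:C)%C * d + z : R[i]^o) (1 : R[i]^o) f L ->
  is_derive t (1 : R) (fun s => complex.Re (f ((s%:C)%C * d + z)))
    (complex.Re (L * d)).
Proof.
move=> d1 df.
have lim : (fun s : R =>
  s^-1 *: (complex.Re (f (((s *: (1 : R) + t)%:C)%C * d + z)) -
    complex.Re (f ((t%:C)%C * d + z)))) @ 0^' --> complex.Re (L * d).
  apply/cvgrPdist_le => e e0; near=> s.
  have : `|L * d - (s^-1)%:C%C * (f ((s%:C)%C * d + ((t%:C)%C * d + z)) -
      f ((t%:C)%C * d + z))| <= e%:C%C.
    by near: s; exact: (cvg_path_quotient d1 df e0).
  rewrite addrA -mulrDl -rmorphD /GRing.scale/= mulr1 => /normr_Re_le.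
  by rewrite Re_subc [X in _ - X]Re_mulc /= mul0r subr0 Re_subc.
by apply: DeriveDef; [apply/cvg_ex; exists (complex.Re (L * d))|exact: cvg_lim lim].
Unshelve. all: by end_near. Qed.

Lemma is_derive_Im_path f z d (t : R) (L : R[i]) : `|d| = 1 ->
  is_derive ((t%:C)%C * d + z : R[i]^o) (1 : R[i]^o) f L ->
  is_derive t (1 : R) (fun s => complex.Im (f ((s%:C)%C * d + z)))
    (complex.Im (L * d)).
Proof.
move=> d1 df.
have lim : (fun s : R =>
  s^-1 *: (complex.Im (f (((s *: (1 : R) + t)%:C)%C * d + z)) -
    complex.Im (f ((t%:C)%C * d + z)))) @ 0^' --> complex.Im (L * d).
  apply/cvgrPdist_le => e e0; near=> s.
  have : `|L * d - (s^-1)%:C%C * (f ((s%:C)%C * d + ((t%:C)%C * d + z)) -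
      f ((t%:C)%C * d + z))| <= e%:C%C.
    by near: s; exact: (cvg_path_quotient d1 df e0).
  rewrite addrA -mulrDl -rmorphD /GRing.scale/= mulr1 => /normr_Im_le.
  by rewrite Im_subc [X in _ - X]Im_mulc /= mul0r addr0 Im_subc.
by apply: DeriveDef; [apply/cvg_ex; exists (complex.Im (L * d))|exact: cvg_lim lim].
Unshelve. all: by end_near. Qed.

(* Every point of the half-plane is reached from any other one by a horizontal
   line followed by the vertical half-line [s |-> expR s]. *)
Lemma half_plane_derive0_cst f :
  (forall z, 0 < complex.Im z -> is_derive (z : R[i]^o) (1 : R[i]^o) f 0) ->
  forall z z', 0 < complex.Im z -> 0 < complex.Im z' -> f z = f z'.
Proof.
move=> df z z' z0 z0'.
have n1 : `|1| = 1 :> R[i] by exact: normr1.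
have ni : `|'i%C| = 1 :> R[i].
  by rewrite normc_def /= expr0n/= expr1n add0r sqrtr1.
pose w := (complex.Re z' +i* complex.Im z)%C.
have hor (t : R) : is_derive ((t%:C)%C * 1 + (0 +i* complex.Im z)%C :
  R[i]^o) (1 : R[i]^o) f 0.
  by apply: df; rewrite !complex_partsE /= mul0r mulr0 addr0 add0r.
(* The exponential keeps the path in the half-plane for every real parameter, so the criterion for
   constancy on the whole line applies. *)
have ver (t : R) : is_derive (((expR t)%:C)%C * 'i%C + ((complex.Re z')%:C)%C :
  R[i]^o) (1 : R[i]^o) f 0.
  by apply: df; rewrite !complex_partsE /= mul0r mulr1 !addr0 expR_gt0.
have horE (u : R[i]) : complex.Im u = complex.Im z ->
    u = ((complex.Re u)%:C)%C * 1 + (0 +i* complex.Im z)%C.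
  by case: u => a b /= ->; rewrite mulr1; apply/eqP;
    rewrite eq_complex /= addr0 add0r !eqxx.
have verE (u : R[i]) : complex.Re u = complex.Re z' -> 0 < complex.Im u ->
    u = ((expR (ln (complex.Im u)))%:C)%C * 'i%C + ((complex.Re z')%:C)%C.
  case: u => a b /= -> b0; rewrite lnK//; apply/eqP.
  by rewrite eq_complex /= !mul0r mulr0 mulr1 subr0 add0r !addr0 !eqxx.
have hw : f z = f w.
  rewrite (horE z)// (horE w)//; apply/eqP; rewrite eq_complex; apply/andP;
    split; apply/eqP.
    apply: (is_derive_0_is_cst (f := fun s =>
      complex.Re (f ((s%:C)%C * 1 + (0 +i* complex.Im z)%C)))).
    by move=> t; have := is_derive_Re_path n1 (hor t); rewrite mul0r.
  apply: (is_derive_0_is_cst (f := fun s =>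
    complex.Im (f ((s%:C)%C * 1 + (0 +i* complex.Im z)%C)))).
  by move=> t; have := is_derive_Im_path n1 (hor t); rewrite mul0r.
have verC (x y : R) : f (((expR x)%:C)%C * 'i%C + ((complex.Re z')%:C)%C) =
    f (((expR y)%:C)%C * 'i%C + ((complex.Re z')%:C)%C).
  apply/eqP; rewrite eq_complex; apply/andP; split; apply/eqP.
    apply: (is_derive_0_is_cst (f := fun s =>
      complex.Re (f (((expR s)%:C)%C * 'i%C + ((complex.Re z')%:C)%C)))).
    move=> t; have := is_derive1_comp (is_derive_Re_path ni (ver t))
      (is_derive_expR t).
    by rewrite mul0r mul0r.
  apply: (is_derive_0_is_cst (f := fun s =>
    complex.Im (f (((expR s)%:C)%C * 'i%C + ((complex.Re z')%:C)%C)))).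
  move=> t; have := is_derive1_comp (is_derive_Im_path ni (ver t))
    (is_derive_expR t).
  by rewrite mul0r mul0r.
by rewrite hw (verE w erefl z0) (verC _ (ln (complex.Im z'))) -(verE z' erefl z0').
Qed.

End HalfPlane.

(** * Cycles of length two *)

Section TwoCycle.
Context {R : realType}.

Lemma Rintegral_eq0_ae d (T : measurableType d) (P : probability T R) (f : T -> R) :
  bounded_mfun f -> (forall x, 0 <= f x) -> \int[P]_x f x = 0 ->
  {ae P, forall x, f x = 0}.
Proof.
move=> bf f0 If; have intf := bounded_mfun_integrable P bf.
have mf : measurable_fun setT (EFin \o f) by apply/measurable_EFinP; case: bf.
have : (\int[P]_x `|(EFin \o f) x| = 0)%E.
  under eq_integral do rewrite gee0_abs ?lee_fin//.
  by rewrite -[LHS]fineK ?integrable_fin_num// -/(Rintegral _ _ _) If.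
move/(ae_eq_integral_abs P measurableT mf).1; apply: filterS => x /(_ I) /=.
by case.
Qed.

(** If the integral were zero, [f] would vanish almost everywhere and the whole space would be
    null. *)
Lemma Rintegral_gt0 d (T : measurableType d) (P : probability T R) (f : T -> R) :
  bounded_mfun f -> (forall x, 0 < f x) -> 0 < \int[P]_x f x.
Proof.
move=> bf f0; rewrite lt_neqAle Rintegral_ge0 ?andbT; last by move=> x _;
  exact: ltW.
apply/eqP => /esym If.
have [N [mN N0 sN]] := Rintegral_eq0_ae bf (fun x => ltW (f0 x)) If.
have NT : N = setT.
  by apply/seteqP; split => // x _; apply: sN => /= fx; have := f0 x;
    rewrite fx ltxx.
by move/eqP: N0; rewrite NT probability_setT eqe oner_eq0.
Qed.

Lemma poisson_im_gt0 (eta u : R) : 0 < eta -> 0 < poisson_im eta u.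
Proof. by move=> e0; rewrite divr_gt0// poisson_den_gt0. Qed.

Lemma Im_cauchy_transform_gt0 (nu : probability R R) (z : R[i]) :
  0 < complex.Im z -> 0 < complex.Im (cauchy_transform nu z).
Proof.
move=> z0; have [_ br] := bounded_cmfun_resolvent z0.
by apply: Rintegral_gt0 => // w; rewrite Im_resolvent poisson_im_gt0.
Qed.

(** The 4 is a factor 2 for the modulus of the resolvent times a factor 2 for that of the
    expectation. *)
Lemma norm_cauchy_transform_le (nu : probability R R) (z : R[i]) :
  0 < complex.Im z ->
  `|cauchy_transform nu z| <= (4 / complex.Im z)%:C%C.
Proof.
move=> z0; rewrite (_ : 4 / complex.Im z = 2 * (2 / complex.Im z));
  last by rewrite mulrA; congr (_ / _); ring.
apply: norm_cexpect_le; first exact: bounded_cmfun_resolvent.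
by move=> w; exact: norm_resolvent_le.
Qed.

Lemma cauchy_transform_eq_of_derive (mu nu : probability R R) :
  (forall z : R[i]^o, 0 < complex.Im z ->
    exists2 L : R[i], is_derive z (1 : R[i]^o) (cauchy_transform mu) L &
      is_derive z (1 : R[i]^o) (cauchy_transform nu) L) ->
  forall z : R[i], 0 < complex.Im z ->
    cauchy_transform mu z = cauchy_transform nu z.
Proof.
move=> H z z0; pose F (z : R[i]^o) : R[i]^o :=
  cauchy_transform mu z - cauchy_transform nu z.
have dF (u : R[i]) : 0 < complex.Im u -> is_derive (u : R[i]^o) (1 : R[i]^o) F 0.
  by move=> u0; have [L h1 h2] := H u u0;
    have /is_derive_eq := is_deriveB h1 h2; apply; rewrite subrr.
have cF := half_plane_derive0_cst dF.
apply/eqP; rewrite -subr_eq0 -/(F z) -normr_eq0 eq_le normr_ge0 andbT.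
have nE : `|F z| = (complex.Re `|F z|)%:C%C by rewrite RRe_real// ger0_real.
rewrite nE lecR; apply/ler_addgt0Pr => e e0; rewrite add0r.
(* The difference is constant, so it may be evaluated high up; at height 8 / e each transform is at
   most e / 2 in modulus. *)
pose w := (0 +i* (8 / e))%C : R[i].
have w0 : 0 < complex.Im w by rewrite /= divr_gt0.
rewrite -lecR -nE (cF z w z0 w0) /F; apply: le_trans (ler_normB _ _) _.
apply: le_trans (lerD (norm_cauchy_transform_le mu w0)
  (norm_cauchy_transform_le nu w0)) _.
rewrite -rmorphD lecR /= (_ : 4 / (8 / e) + 4 / (8 / e) = e)//.
by field; rewrite gt_eqF.
Qed.

(** Since Im y > 0, [y] never vanishes, and 1 / y + z has derivative - y' / y^2 + 1 = 0, hence is a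
    constant [k]. The sign of Im k also comes from Im y > 0. *)
Lemma cauchy_transform_homographic (nu : probability R R) :
  (forall z : R[i]^o, 0 < complex.Im z ->
    is_derive z (1 : R[i]^o) (cauchy_transform nu)
      (cauchy_transform nu z * cauchy_transform nu z)) ->
  exists a b : R, 0 <= b /\ forall z : R[i], 0 < complex.Im z ->
    cauchy_transform nu z = ((a -i* b)%C - z)^-1.
Proof.
move=> dy; set y := cauchy_transform nu in dy *.
have y0 (z : R[i]) : 0 < complex.Im z -> y z != 0.
  by move=> /(Im_cauchy_transform_gt0 nu); rewrite -/(y z);
    apply: contraTneq => ->; rewrite ltxx.
pose K (z : R[i]^o) : R[i]^o := (y z)^-1 + z.
have dK (z : R[i]) : 0 < complex.Im z -> is_derive (z : R[i]^o) (1 : R[i]^o) K 0.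
  move=> z0; have dz := dy z z0.
  have di : is_derive (z : R[i]^o) (1 : R[i]^o) (fun z => (y z)^-1) (-1).
    apply: DeriveDef; first by apply: derivableV; [exact: y0|case: dz].
    rewrite deriveV; [|exact: y0|by case: dz].
    by rewrite derive_val /GRing.scale/= mulNr -expr2 mulVf// expf_neq0// y0.
  by have /is_derive_eq :=
    is_deriveD di (is_derive_id (z : R[i]^o) (1 : R[i]^o)); apply; rewrite addNr.
have cK := half_plane_derive0_cst dK.
pose k : R[i] := K 'i%C; pose a := complex.Re k; pose b := - complex.Im k.
have kE : (a -i* b)%C = k by apply/eqP; rewrite eq_complex /= opprK !eqxx.
have yE (z : R[i]) : 0 < complex.Im z -> y z = (k - z)^-1.
  by move=> z0; rewrite /k (cK 'i%C z) ?ltr01// /K addrK invrK.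
exists a, b; split; last by move=> z z0; rewrite kE yE.
rewrite oppr_ge0; apply/ler_addgt0Pr => e e0; rewrite add0r leNgt; apply/negP => ek.
(* If Im k > e > 0, then k - i e has positive imaginary part and its inverse y(i e) a negative one,
   a contradiction. *)
pose z := (0 +i* e)%C : R[i].
have := Im_cauchy_transform_gt0 nu (z := z) e0; rewrite -/y yE//.
case: (k) ek => k1 k2 /= ek; rewrite oppr_gt0 pmulr_llt0 ?invr_gt0;
  first by rewrite subr_lt0 ltNge ltW.
by rewrite ltr_wpDl ?sqr_ge0// exprn_even_gt0//= gt_eqF// subr_gt0.
Qed.

(** Imaginary parts at z = xi + i eta: smoothing [nu] at height eta amounts to raising the height in
    the kernel centred at [a] by [b]. *)
Lemma cauchy_transform_Poisson (nu : probability R R) (a b : R) :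
  (forall z : R[i], 0 < complex.Im z ->
    cauchy_transform nu z = ((a -i* b)%C - z)^-1) ->
  forall eta xi : R, 0 < eta ->
  \int[nu]_w poisson_im eta (w - xi) = poisson_im (b + eta) (a - xi).
Proof.
move=> H eta xi e0; pose z := (xi +i* eta)%C : R[i].
have -> : \int[nu]_w poisson_im eta (w - xi) = complex.Im (cauchy_transform nu z).
  by apply: eq_Rintegral => w _; rewrite -(Im_resolvent z).
by rewrite H//= /poisson_im -opprD sqrrN mulNr opprK.
Qed.

(** The function 1 - 1 / ((w - a)^2 + 1) is nonnegative with mean zero and vanishes only at [a], so
    every measurable set avoiding [a] is null. *)
Lemma is_Dirac_of_Poisson (nu : probability R R) (a : R) :
  \int[nu]_w poisson_im 1 (w - a) = poisson_im 1 0 -> is_Dirac nu.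
Proof.
rewrite [RHS](_ : _ = 1); last by rewrite /poisson_im expr0n/= add0r expr1n divr1.
move=> I1; exists a.
have msub : measurable_fun setT (fun w : R => w - a) by exact: measurable_funB.
have bp : bounded_mfun (fun w : R => poisson_im 1 (w - a)).
  apply: (bounded_mfun_comp (f := poisson_im 1) msub); split.
    by apply: continuous_measurable_fun; exact: continuous_poisson_im.
  by exists 1^-1 => x; exact: normr_poisson_im.
have bq : bounded_mfun (fun w : R => 1 - poisson_im 1 (w - a)).
  by apply: bounded_mfunB => //; exact: bounded_mfun_cst.
have p1 (u : R) : 0 <= 1 - poisson_im 1 u.
  rewrite subr_ge0; have := normr_poisson_im (@ltr01 R) u.
  by rewrite invr1 => /ler_normlP[].
have Iq : \int[nu]_w (1 - poisson_im 1 (w - a)) = 0.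
  rewrite (RintegralB measurableT
    (bounded_mfun_integrable nu (bounded_mfun_cst _ (1 : R)))
    (bounded_mfun_integrable nu bp)).
  by rewrite Rintegral_prob_cst I1 subrr.
have [N [mN N0 sN]] := Rintegral_eq0_ae bq (fun w => p1 _) Iq.
have outN w : w != a -> N w.
  move=> wa; apply: sN => /= /eqP; rewrite subr_eq0 eq_sym => /eqP.
  rewrite /poisson_im expr1n mul1r => /(congr1 GRing.inv); rewrite invrK invr1.
  move/eqP; rewrite -subr_eq0 addrK expf_eq0/= subr_eq0; exact/negP.
have sub_null A : measurable A -> ~ A a -> nu A = 0%E.
  move=> mA nAa; apply: (subset_measure0 _ _ _ N0) => //.
  by move=> w Aw; apply: outN; apply: contra_not_neq nAa => <-.
move=> A mA; rewrite diracE; case: (pselect (A a)) => Aa.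
  rewrite mem_set//; have mC := measurableC mA.
  have CA0 : nu (~` A) = 0%E by apply: sub_null => //; exact.
  by have := probability_setC nu mC; rewrite setCK CA0 sube0.
by rewrite memNset// sub_null.
Qed.

End TwoCycle.

(** * Stieltjes inversion *)

Section StieltjesInversion.
Context {R : realType}.

Lemma is_derive_atan_scaled (eta w x : R) : 0 < eta ->
  is_derive (x : R) (1 : R) (fun x : R =>
    atan ((x - w) / eta)) (poisson_im eta (x - w)).
Proof.
move=> e0.
have da : is_derive (x : R) (1 : R) (fun x : R => (x - w) / eta) (eta^-1).
  by apply: is_derive_eq; rewrite /GRing.scale/=; ring.
have /is_derive_eq := is_derive1_comp
  (g := fun x : R => (x - w) / eta) (is_derive1_atan ((x - w) / eta)) da; apply.
have := poisson_den_gt0 e0 (x - w) => /lt0r_neq0 h.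
by rewrite /poisson_im; field; apply/andP; split; [exact: h|rewrite gt_eqF].
Qed.

Lemma normr_atan_le (x : R) : `|atan x| <= pi / 2.
Proof. by rewrite ler_norml !ltW ?atan_gtNpi2 ?atan_ltpi2. Qed.

Lemma measurable_atan_scaled (k x : R) :
  measurable_fun setT (fun w : R => atan ((x - w) * k)).
Proof.
apply: (measurableT_comp (f := @atan R)).
  by apply: continuous_measurable_fun => y; exact: continuous_atan.
by apply: measurable_funM => //; exact: measurable_funB.
Qed.

Lemma bounded_mfun_atan_scaled (k x : R) :
  bounded_mfun (fun w : R => atan ((x - w) * k)).
Proof.
by split; [exact: measurable_atan_scaled|exists (pi / 2) => w;
  exact: normr_atan_le].
Qed.

Lemma poisson_imN (eta u : R) : poisson_im eta (- u) = poisson_im eta u.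
Proof. by rewrite /poisson_im sqrrN. Qed.

(** Differentiation under the integral sign: the derivative in [x] is a Poisson kernel, dominated by
    the constant 1 / eta. *)
Lemma is_derive_Rintegral_atan (nu : probability R R) (eta x : R) : 0 < eta ->
  is_derive (x : R) (1 : R) (fun x : R => \int[nu]_w atan ((x - w) / eta))
    (\int[nu]_w poisson_im eta (w - x)).
Proof.
move=> e0.
pose f (x w : R) := atan ((x - w) / eta).
have df (y w : R) : is_derive (y : R) (1 : R) (f ^~ w) (poisson_im eta (y - w)).
  exact: is_derive_atan_scaled.
have pE y w : partial1of2 f y w = poisson_im eta (w - y).
  by rewrite partial1of2E -opprB poisson_imN; case: (df y w).
have : h^-1 *: (\int[nu]_w f (h + x) w - \int[nu]_w f x w) @[h --> 0^'] -->
    \int[nu]_w (partial1of2 f) x w.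
  apply: (@cvg_differentiation_under_integral _ _ _ nu f setT measurableT x
    (x - 1) (x + 1) _ _ _ (cst eta^-1)).
  - by rewrite /= in_itv/= ltrBlDr !ltrDl ltr01.
  - by move=> y _; apply: bounded_mfun_integrable; exact: bounded_mfun_atan_scaled.
  - by move=> y w _ _; case: (df y w).
  - by move=> w; rewrite invr_ge0 ltW.
  - exact: finite_measure_integrable_cst.
  - by move=> y w _ _; have := normr_poisson_im e0 (w - y); rewrite -pE.
have -> : \int[nu]_w (partial1of2 f) x w = \int[nu]_w poisson_im eta (w - x).
  by apply: eq_Rintegral => w _; exact: pE.
move=> h; have h' : (fun h =>
  h^-1 *: (\int[nu]_w f (h *: (1 :
    R) + x) w - \int[nu]_w f x w)) @ 0^' --> \int[nu]_w poisson_im eta (w - x).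
  by under eq_fun do rewrite [_ *: 1]mulr1.
by apply: DeriveDef; [apply/cvg_ex; eexists; exact: h'|exact: cvg_lim h'].
Qed.

(** The factor [n.+1] stands for 1 / eta; the convention sg 0 = 0 matches atan 0 = 0. *)
Lemma cvg_atan_sgr (x : R) :
  atan (x * n.+1%:R) @[n --> \oo] --> pi / 2 * Num.sg x.
Proof.
wlog x0 : x / 0 <= x.
  move=> H; have [/H//|/ltW x0] := leP 0 x.
  rewrite -[x]opprK sgrN mulrN.
  under eq_fun do rewrite mulNr atanN.
  by apply: cvgN; apply: H; rewrite oppr_ge0.
move: x0; rewrite le_eqVlt => /predU1P[<-|x0].
  rewrite sgr0 mulr0; under eq_fun do rewrite mul0r atan0.
  exact: cvg_cst.
rewrite gtr0_sg// mulr1.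
have h : x * n.+1%:R @[n --> \oo] --> +oo.
  have hn : n.+1%:R @[n --> \oo] --> (+oo : set_system R).
    by rewrite (cvg_shiftS (fun n : nat => n%:R : R)); exact: cvgr_idn.
  have hx : x * r @[r --> +oo] --> +oo by apply: (gt0_cvgMry (f := id) x0);
    exact: cvg_id.
  exact: (cvg_comp _ _ hn hx).
apply: (@cvg_comp _ _ _ (fun n : nat => x * n.+1%:R) (@atan R) _ _ _ h).
exact: cvgy_atan.
Qed.

Section CauchyLaw.
Variables (nu : probability R R) (a b : R).
Hypothesis b0 : 0 < b.
Hypothesis nuP : forall eta xi : R, 0 < eta ->
  \int[nu]_w poisson_im eta (w - xi) = poisson_im (b + eta) (a - xi).

(** [g] is pi times the Cauchy distribution function, up to an additive constant. [phi c d] is the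
    limit of the arctangent increments as eta tends to 0: for c < d it is pi inside the interval, pi
    / 2 at its end points and 0 outside. *)
Let g (x : R) := atan ((x - a) / b).
Let phi (c d w : R) := pi / 2 * Num.sg (d - w) - pi / 2 * Num.sg (c - w).

(** As functions of the end point, the two arctangent expressions have the same derivative by [nuP],
    so their difference [F] is constant. No exchange of integrals is required. *)
Lemma Rintegral_atan_increment (eta c d : R) : 0 < eta ->
  \int[nu]_w (atan ((d - w) / eta) - atan ((c - w) / eta)) =
  atan ((d - a) / (b + eta)) - atan ((c - a) / (b + eta)).
Proof.
move=> e0; have be0 : 0 < b + eta by rewrite addr_gt0.
pose F (x : R) := \int[nu]_w atan ((x - w) / eta) - atan ((x - a) / (b + eta)).
have dF (x : R) : is_derive (x : R) (1 : R) F 0.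
  have /is_derive_eq := is_deriveB (is_derive_Rintegral_atan nu x e0)
    (is_derive_atan_scaled a x be0).
  by apply; rewrite nuP// -[a - x]opprB poisson_imN subrr.
have := is_derive_0_is_cst d c dF; rewrite /F => e.
rewrite (RintegralB measurableT (bounded_mfun_integrable nu
  (bounded_mfun_atan_scaled eta^-1 d))
  (bounded_mfun_integrable nu (bounded_mfun_atan_scaled eta^-1 c))).
lra.
Qed.

Let continuous_g : continuous g.
Proof.
move=> x; apply: (@continuous_comp _ _ _ (fun x => (x - a) / b) (@atan R));
  last exact: continuous_atan.
by apply: cvgM; [apply: cvgB; [exact: cvg_id|exact: cvg_cst]|exact: cvg_cst].
Qed.

Let measurable_sg (x : R) : measurable_fun setT (fun w : R => Num.sg (x - w)).
Proof.
apply: (@measurable_fun_cvg _ _ _ setT (fun n (w : R) =>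
  (pi / 2)^-1 * atan ((x - w) * n.+1%:R))) => [n|w _].
  by apply: measurable_funM => //; exact: measurable_atan_scaled.
rewrite -[X in _ --> X](mulKf (_ : pi / 2 != 0)) ?gt_eqF ?divr_gt0 ?pi_gt0//.
by apply: cvgM; [exact: cvg_cst|exact: cvg_atan_sgr].
Qed.

(** Along eta = 1 / (n + 1) the integrals of the increments converge to the left side by bounded
    convergence and to the right side by continuity of the arctangent. *)
Lemma Rintegral_phi (c d : R) : \int[nu]_w phi c d w = g d - g c.
Proof.
pose eta (n : nat) : R := n.+1%:R^-1.
have e0 n : 0 < eta n by rewrite invr_gt0.
have eta_cvg : eta n @[n --> \oo] --> (0 : R) by exact: cvg_harmonic.
pose f n w := atan ((d - w) / eta n) - atan ((c - w) / eta n).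
have lim1 : \int[nu]_w f n w @[n --> \oo] --> \int[nu]_w phi c d w.
  apply: (@cvg_Rintegral_bounded _ _ _ _ _ _ (pi / 2 + pi / 2)).
  - by move=> n; apply: measurable_funB; exact: measurable_atan_scaled.
  - by apply: measurable_funB; apply: measurable_funM => //; exact: measurable_sg.
  - by move=> n w; apply: le_trans (ler_normB _ _) _; rewrite lerD ?normr_atan_le.
  - apply: aeW => w; apply: cvgB.
      by under eq_fun do rewrite invrK; exact: cvg_atan_sgr.
    by under eq_fun do rewrite invrK; exact: cvg_atan_sgr.
have gl x : atan ((x - a) / (b + eta n)) @[n --> \oo] --> g x.
  apply: (cvg_comp (fun n => (x - a) / (b + eta n)) (@atan R));
    last exact: continuous_atan.
  apply: cvgM; first exact: cvg_cst.
  apply: cvgV; first by rewrite gt_eqF.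
  by rewrite -[X in _ --> X]addr0; apply: cvgD => //; exact: cvg_cst.
have lim2 : \int[nu]_w f n w @[n --> \oo] --> g d - g c.
  under eq_fun do rewrite /f Rintegral_atan_increment//.
  by apply: cvgB; exact: gl.
by apply: (cvg_unique _ lim1 lim2).
Qed.

Let measurable_phi (c d : R) : measurable_fun setT (phi c d).
Proof. by apply: measurable_funB; apply: measurable_funM => //;
  exact: measurable_sg. Qed.

Let pi2_ge0 : 0 <= pi / 2 :> R.
Proof. by rewrite divr_ge0 ?pi_ge0. Qed.

Let bounded_phi (c d : R) : bounded_mfun (phi c d).
Proof.
split; first exact: measurable_phi.
have sgM (x : R) : `|pi / 2 * Num.sg x| <= pi / 2.
  rewrite normrM [X in X * _]ger0_norm// ler_piMr//.
  by rewrite normr_sg; case: (_ != _).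
by exists (pi / 2 + pi / 2) => w; apply: le_trans (ler_normB _ _) _; rewrite lerD.
Qed.

Let Rintegral_pi_indic A : measurable A ->
  \int[nu]_w (pi * \1_A w) = pi * fine (nu A).
Proof.
move=> mA; rewrite RintegralZl//; last first.
  by apply: bounded_mfun_integrable; split => //; exists 1 => w;
    rewrite indicE; case: (_ \in _); rewrite ?normr1 ?normr0.
by congr (_ * fine _); rewrite integral_indic// setIT.
Qed.

Let bounded_pi_indic A : measurable A -> bounded_mfun (fun w : R =>
  pi * (\1_A w : R)).
Proof.
move=> mA; apply: bounded_mfunM; first exact: bounded_mfun_cst.
by split => //; exists 1 => w; rewrite indicE; case: (_ \in _);
  rewrite ?normr1 ?normr0.
Qed.

Let phi_ge0 (c d w : R) : c <= d -> 0 <= phi c d w.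
Proof.
move=> cd; rewrite /phi -mulrBr mulr_ge0// subr_ge0.
by case: (sgrP (c - w)); case: (sgrP (d - w)); lra.
Qed.

Let phi_pi (c d w : R) : c < w < d -> phi c d w = pi.
Proof.
move=> /andP[cw wd]; rewrite /phi gtr0_sg ?subr_gt0// ltr0_sg ?subr_lt0//; lra.
Qed.

Let phi_le_pi (c d w : R) : phi c d w <= pi.
Proof.
rewrite /phi; have := pi_ge0 R.
by case: (sgrP (c - w)); case: (sgrP (d - w)); lra.
Qed.

Let phi_out (c d w : R) : c <= d -> ~~ (c <= w <= d) -> phi c d w = 0.
Proof.
move=> cd; rewrite negb_and -!ltNge /phi => /orP[wc|dw].
  by rewrite !gtr0_sg ?subrr ?subr_gt0// (lt_le_trans wc).
by rewrite !ltr0_sg ?subrr ?subr_lt0// (le_lt_trans cd).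
Qed.

(** Here and in [cc_ge], [phi c d] lies between pi times the indicators of the open and of the
    closed interval. Atoms at the end points are not yet excluded, so the two bounds concern
    different intervals. *)
Let oo_le (c d : R) : c <= d -> pi * fine (nu `]c, d[%classic) <= g d - g c.
Proof.
move=> cd; rewrite -Rintegral_phi -Rintegral_pi_indic//.
apply: le_Rintegral => //;
  [exact: bounded_mfun_integrable (bounded_pi_indic _)|exact:
    bounded_mfun_integrable|].
move=> w _; rewrite indicE; case: (boolP (w \in _)) => [|_];
  last by rewrite mulr0 phi_ge0.
by rewrite inE/= in_itv/= => cwd; rewrite mulr1 phi_pi.
Qed.

Let cc_ge (c d : R) : c <= d -> g d - g c <= pi * fine (nu `[c, d]%classic).
Proof.
move=> cd; rewrite -Rintegral_phi -Rintegral_pi_indic//.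
apply: le_Rintegral => //;
  [exact: bounded_mfun_integrable|exact: bounded_mfun_integrable
    (bounded_pi_indic _)|].
move=> w _; rewrite indicE; case: (boolP (w \in _)) => [_|];
  first by rewrite mulr1 phi_le_pi.
by rewrite notin_setE/= in_itv/= mulr0 => /negP cwd; rewrite phi_out.
Qed.

(** The interval ]c, d] lies inside ]c, d + e[ and contains [c + e, d]; as e decreases to 0,
    continuity of [g] closes the gap. *)
Lemma Poisson_measure_itv (c d : R) : c < d ->
  nu `]c, d]%classic = (pi^-1 * (g d - g c))%:E.
Proof.
move=> cd.
have nuf A : measurable A -> (fine (nu A))%:E = nu A.
  by move=> mA; rewrite fineK// fin_num_measure.
have mono A B : measurable A -> measurable B -> A `<=` B ->
  fine (nu A) <= fine (nu B).
  by move=> mA mB AB; rewrite -lee_fin !nuf//; apply: le_measure => //; rewrite inE.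
rewrite -nuf//; congr (_%:E).
suff e : pi * fine (nu `]c, d]%classic) = g d - g c
  by rewrite -e mulKf// gt_eqF// pi_gt0.
apply/eqP; rewrite eq_le; apply/andP; split.
- have lim : g (d + e) - g c @[e --> (0 : R)^'+] --> g d - g c.
    apply: cvgB; last exact: cvg_cst.
    apply: cvg_at_right_filter.
    have ce : g (d + e) @[e --> (0 : R)] --> g (d + 0).
      apply: (@continuous_comp _ _ _ (fun e => d + e) g (0 : R));
        last exact: continuous_g.
      by apply: cvgD; [exact: cvg_cst|exact: cvg_id].
    by move: ce; rewrite addr0.
  apply: (cvgr_to_ge lim).
  near=> e; have e0 : 0 < e by near: e; exact: nbhs_right_gt.
  apply: (le_trans _ (@oo_le c (d + e) _)); last by rewrite ler_wpDr ?ltW// ltW.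
  rewrite ler_wpM2l ?pi_ge0// mono// => x /=; rewrite !in_itv/= => /andP[-> xd] /=.
  by rewrite (le_lt_trans xd)// ltrDl.
- have lim : g d - g (c + e) @[e --> (0 : R)^'+] --> g d - g c.
    apply: cvgB; first exact: cvg_cst.
    apply: cvg_at_right_filter.
    have ce : g (c + e) @[e --> (0 : R)] --> g (c + 0).
      apply: (@continuous_comp _ _ _ (fun e => c + e) g (0 : R));
        last exact: continuous_g.
      by apply: cvgD; [exact: cvg_cst|exact: cvg_id].
    by move: ce; rewrite addr0.
  apply: (cvgr_to_le lim).
  near=> e; have e0 : 0 < e by near: e; exact: nbhs_right_gt.
  have ecd : c + e < d by rewrite -ltrBrDl; near: e; apply: nbhs_right_lt;
    rewrite subr_gt0.
  apply: (le_trans (@cc_ge (c + e) d _)); first exact: ltW.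
  rewrite ler_wpM2l ?pi_ge0// mono// => x /=; rewrite !in_itv/= => /andP[cx ->].
  by rewrite andbT (lt_le_trans _ cx)// ltrDl.
Unshelve. all: by end_near. Qed.

End CauchyLaw.
End StieltjesInversion.

(** * The Cauchy measure and its determination by intervals *)

Section CauchyMeasure.
Context {R : realType}.
Variables (a b : R).
Hypothesis b0 : 0 < b.
Local Notation leb := (@lebesgue_measure R).

Definition cauchy_pdf (x : R) : R := pi^-1 * (b / ((x - a) ^+ 2 + b ^+ 2)).

Lemma cauchy_pdf_ge0 x : 0 <= cauchy_pdf x.
Proof.
apply: mulr_ge0; first by rewrite invr_ge0 pi_ge0.
exact: ltW (poisson_im_gt0 (x - a) b0).
Qed.

Lemma continuous_cauchy_pdf : continuous cauchy_pdf.
Proof.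
move=> x; apply: cvgM; first exact: cvg_cst.
apply: (@continuous_comp _ _ _ (fun x => x - a) (poisson_im b));
  last exact: continuous_poisson_im.
by apply: cvgB; [exact: cvg_id|exact: cvg_cst].
Qed.

Lemma measurable_cauchy_pdf (D : set (measurableTypeR R)) :
  measurable_fun D (fun x : measurableTypeR R => (cauchy_pdf x)%:E).
Proof.
apply: measurable_funTS; apply/measurable_EFinP.
exact: (continuous_measurable_fun continuous_cauchy_pdf).
Qed.

(** The set function of [is_Cauchy], given a measure structure below so that uniqueness of measures
    applies to it. *)
Definition cauchy_measure (A : set (measurableTypeR R)) : \bar R :=
  (\int[leb]_(x in A) (cauchy_pdf x)%:E)%E.

Let cauchy_measure0 : cauchy_measure set0 = 0%E.
Proof. by rewrite /cauchy_measure integral_set0. Qed.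

Let cauchy_measure_ge0 A : (0 <= cauchy_measure A)%E.
Proof. by apply: integral_ge0 => x _; rewrite lee_fin cauchy_pdf_ge0. Qed.

Let cauchy_measure_sigma_additive : semi_sigma_additive cauchy_measure.
Proof.
move=> /= F mF tF mUF; rewrite /cauchy_measure; apply: cvg_toP.
  apply: ereal_nondecreasing_is_cvgn => m n mn.
  by apply: lee_sum_nneg_natr => // k _ _; exact: cauchy_measure_ge0.
rewrite ge0_integral_bigcup//=; first exact: measurable_cauchy_pdf.
by move=> x _; rewrite lee_fin cauchy_pdf_ge0.
Qed.

HB.instance Definition _ := isMeasure.Build _ _ _ cauchy_measure
  cauchy_measure0 cauchy_measure_ge0 cauchy_measure_sigma_additive.

Lemma cauchy_measure_itv (c d : R) : c < d ->
  cauchy_measure `]c, d]%classic =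
  (pi^-1 * (atan ((d - a) / b) - atan ((c - a) / b)))%:E.
Proof.
(* The left end point is Lebesgue-null, so the interval is closed before the fundamental theorem of
   calculus is used. *)
move=> cd; rewrite /cauchy_measure integral_itv_obnd_cbnd;
  last exact: measurable_cauchy_pdf.
pose F x : R := pi^-1 * atan ((x - a) / b).
have dF (x : R) : is_derive (x : R) (1 : R) F (cauchy_pdf x).
  have /is_derive_eq := is_deriveZ (pi^-1 : R) (is_derive_atan_scaled a x b0).
  exact.
have cF := is_derive1_continuous dF.
have dFw : derivable_oo_LRcontinuous F c d.
  split=> [y _||]; first by case: (dF y).
    by apply: cvg_at_right_filter; exact: cF.
  by apply: cvg_at_left_filter; exact: cF.
have dFE : {in `]c, d[, derive1 F =1 cauchy_pdf}.
  by move=> y _; rewrite derive1E; case: (dF y).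
have cp : {within `[c, d], continuous cauchy_pdf}.
  by apply: continuous_subspaceT; exact: continuous_cauchy_pdf.
by rewrite (continuous_FTC2 cd cp dFw dFE) /F -EFinB mulrBr.
Qed.

(** The intervals ]c, d] form a pi-system generating the Borel sets, and the intervals ]-n, n]
    exhaust the line. *)
Lemma is_Cauchy_of_itv (nu : probability R R) :
  (forall c d : R, c < d -> nu `]c, d]%classic =
     (pi^-1 * (atan ((d - a) / b) - atan ((c - a) / b)))%:E) ->
  is_Cauchy nu.
Proof.
move=> nuE; exists a, b; split => // A mA.
have mid : measurable_fun setT (idfun : R -> measurableTypeR R).
  by move=> _ B mB; rewrite setTI.
(* [nu] is transported along the identity to the measurable structure that carries Lebesgue
   measure. *)
pose nu' := distribution nu (mk_RV nu mid).
change (nu' A = cauchy_measure A).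
refine (@measure_unique _ R (measurableTypeR R) (@ocitv R) (fun n =>
  `](- n%:R), n%:R]%classic) _ _ _ _ nu' (cauchy_measure :
    {measure set (measurableTypeR R) -> \bar R}) _ _ A mA).
- by [].
- exact: ocitvI.
- by move=> n; exact: is_ocitv.
- apply/seteqP; split => // x _.
  have [n xn] : exists n, (`|x| < n%:R :> R).
    by exists (Num.bound `|x|); exact: archi_boundP.
  exists n => //=; move: xn; rewrite in_itv/= ltr_norml => /andP[-> /ltW ->].
  by [].
- move=> _ /ocitvP[->|[[c d] /= cd ->]]; first by rewrite !measure0.
  by rewrite cauchy_measure_itv//; exact: nuE.
- by move=> n; rewrite -ge0_fin_numE// fin_num_measure.
Qed.

End CauchyMeasure.

(** * The differential system and the case of period two *)

Unset Implicit Arguments.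

Theorem proposition6p7 (R : realType) (n : nat) (hn : (2 <= n)%N)
    (alpha : probability R R) (mu : nat -> probability R R)
    (halpha : FT1 alpha)
    (hmu1 : is_mu alpha (mu 1%N))
    (hmuS : forall k, (2 <= k <= n)%N -> is_mu (mu k.-1) (mu k))
    (hFT : forall k, (1 <= k <= n.-1)%N -> FT1 (mu k))
    (hcycle : same_law (mu n) alpha) :
  let y := fun j => cauchy_transform (mu j) in
  (forall z : R[i]^o, 0 < complex.Im z ->
     is_derive z (1 : R[i]^o) (y 1%N) (y n z * y 1%N z) /\
     forall j, (2 <= j <= n)%N ->
       is_derive z (1 : R[i]^o) (y j) (y j.-1 z * y j z)) /\
  (n = 2%N -> is_Cauchy alpha \/ is_Dirac alpha).
Proof.
move=> y.
(* This closes the cycle: the transform of [alpha] in the first equation is that of [mu n]. *)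
have yn : y n = cauchy_transform alpha.
  by apply/funext => z; exact: (cexpect_same_law _ hcycle).
have dy (z : R[i]^o) : 0 < complex.Im z ->
     is_derive z (1 : R[i]^o) (y 1%N) (y n z * y 1%N z) /\
     forall j, (2 <= j <= n)%N ->
       is_derive z (1 : R[i]^o) (y j) (y j.-1 z * y j z).
  move=> z0; split=> [|j hj]; first by rewrite yn; exact: is_mu_derive.
  by apply: is_mu_derive => //; exact: hmuS.
split=> [//|n2]; subst n.
(* For period two both derivatives equal the product of [y 1] and [y 2]. *)
have y12 (z : R[i]) : 0 < complex.Im z -> y 1%N z = y 2 z.
  apply: cauchy_transform_eq_of_derive => u u0; exists (y 2 u * y 1%N u);
    first exact: (dy u u0).1.
  by rewrite mulrC; exact: (dy u u0).2.
have [|a [b [b0 yE]]] := @cauchy_transform_homographic R alpha.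
  move=> z z0; rewrite -yn -{1}(y12 z z0); exact: (dy z z0).2.
have nuP := cauchy_transform_Poisson yE.
(* The degenerate scale b = 0 gives the Dirac mass at [a], from the Poisson identity at eta = 1 and
   xi = a; b > 0 gives the Cauchy law. *)
move: b0; rewrite le_eqVlt => /predU1P[b0|b0]; [right|left].
  by apply: (@is_Dirac_of_Poisson _ _ a); rewrite nuP// -b0 add0r subrr.
by apply: (is_Cauchy_of_itv b0) => c d; exact: (Poisson_measure_itv b0 nuP).
Qed.
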